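(* Let $Q_0\subset\mathbb{R}^n$ be a cube, let $0<s\le 1/2^n$, and let $\phi:\mathbb{R}^+\to\mathbb{R}^+$ be continuous and nondecreasing with $\phi(0)=0$ and $\phi(u)>0$ for $u>0$. Then there exist constants $c_1,c_2>0$ such that for every $f\in bmo_{s,\phi}(Q_0)$ and every subcube $Q\subset Q_0$ (the constants being independent of $f$ and of $Q$), $$|\{y\in Q: |f(y)-m_f(1-s,Q)|>\lambda\}|\le c_1\,\Psi_{|Q|}^{-1}\!\left(\frac{c_2\lambda}{\|f\|_{s,\phi,Q}}\right),\qquad \lambda>0.$$
   Context: Cubes have sides parallel to the coordinate axes; $|E|$ is Lebesgue measure; $\mathbb{R}^+=[0,\infty)$. For a cube $Q$, $0<t<1$ and a real-valued measurable $g$ on $Q$, the maximal median is $$m_g(t,Q)=\sup\{M\in\mathbb{R}: |\{y\in Q: g(y)<M\}|\le t|Q|\}.$$ For a cube $Q$ and $f$ measurable on $Q$, $$\|f\|_{s,\phi,Q}=\sup_{Q'\subset Q}\ \inf_{c}\ \frac{m_{|f-c|}(1-s,Q')}{\phi(|Q'|)},$$ the supremum being over cubes $Q'\subset Q$ and the infimum over real constants $c$; $bmo_{s,\phi}(Q_0)$ is the set of measurable functions $f$ on $Q_0$ with $\|f\|_{s,\phi,Q_0}<\infty$. For a cube $Q$, $\Psi_{|Q|}$ is defined for $u\in[0,2^n|Q|]$ by $$\Psi_{|Q|}(u)=\int_u^{2^n|Q|}\frac{\phi(v)}{v}\,dv$$ (possibly $\Psi_{|Q|}(0)=\infty$). It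 is continuous and strictly decreasing on $(0,2^n|Q|]$, and $\Psi_{|Q|}^{-1}$ is its inverse, with the convention $\Psi_{|Q|}^{-1}(y)=0$ when $y\ge\lim_{u\to0^+}\Psi_{|Q|}(u)$; when $\|f\|_{s,\phi,Q}=0$ the right-hand side of the inequality is read as $0$. *)

(* Defs.v *)
From HB Require Import structures.
From mathcomp Require Import all_boot all_order all_algebra.
From mathcomp Require Import all_classical all_reals all_analysis.
Set Implicit Arguments.
Unset Strict Implicit.
Unset Printing Implicit Defensive.
Import Order.TTheory GRing.Theory Num.Theory.
Import numFieldNormedType.Exports.
Local Open Scope classical_set_scope.
Local Open Scope ring_scope.

(* The space R^d, d >= 1, is 'rV[R]_n.+1 with d = n.+1. *)

Section lebesgue_outer_measure.
Context {R : realType} {n : nat}.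
Implicit Types (p : 'rV[R]_n.+1 * 'rV[R]_n.+1) (A : set 'rV[R]_n.+1).

Definition box p : set 'rV[R]_n.+1 :=
  [set x | forall i, p.1 ord0 i <= x ord0 i <= p.2 ord0 i].

(* The truncation at 0 gives volume 0 to the empty boxes. *)
Definition box_volume p : R :=
  \prod_(i < n.+1) Num.max 0 (p.2 ord0 i - p.1 ord0 i).

(* The d-dimensional Lebesgue outer measure. Its restriction to the sigma-algebra
   of Caratheodory measurable sets, carried by [caratheodory_type Leb], is the
   (complete) Lebesgue measure. *)
Definition Leb A : \bar R :=
  ereal_inf [set (\sum_(k <oo) (box_volume (p k))%:E)%E
            | p in [set p | A `<=` \bigcup_k box (p k)]].

Lemma box_volume_ge0 p : 0 <= box_volume p.
Proof. by apply: prodr_ge0 => i _; rewrite le_max lexx. Qed.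

Lemma box_volume0 : box_volume (0, 0) = 0.
Proof. by rewrite /box_volume big_ord_recl/= subrr maxxx mul0r. Qed.

Local Open Scope ereal_scope.

Lemma Leb_ge0 A : 0 <= Leb A.
Proof.
apply: le_ereal_inf_tmp => _ [p _ <-].
by apply: nneseries_ge0 => k _ _; rewrite lee_fin box_volume_ge0.
Qed.

Lemma Leb0 : Leb set0 = 0.
Proof.
apply/eqP; rewrite eq_le Leb_ge0 andbT; apply: ereal_inf_lbound.
exists (fun=> (0%R, 0%R)); first by [].
by apply: eseries0 => k _ _; rewrite box_volume0.
Qed.

Lemma le_Leb : {homo Leb : A B / A `<=` B >-> A <= B}.
Proof.
move=> A B AB; apply/ereal_inf_le_tmp => _ [p Bp <-].
by exists p => //; apply: subset_trans Bp.
Qed.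

Lemma Leb_sigma_subadditive : sigma_subadditive Leb.
Proof.
move=> A; have [[i ioo]|] := pselect (exists i, Leb (A i) = +oo).
  rewrite (eseries_pinfty _ _ ioo) ?leey// => k _.
  by rewrite -ltNye (lt_le_trans _ (Leb_ge0 _)).
rewrite -forallNE => Aoo.
suff add2e (e : {posnum R}) :
    Leb (\bigcup_k A k) <= \sum_(i <oo) Leb (A i) + e%:num%:E.
  by apply/lee_addgt0Pr => _/posnumP[].
rewrite (le_trans _ (epsilon_trick _ _ _))//; last first.
  by move=> k; exact: Leb_ge0.
pose v p := (box_volume p)%:E.
have v_ge0 p : 0 <= v p by rewrite lee_fin box_volume_ge0.
pose P k (q : nat -> 'rV[R]_n.+1 * 'rV[R]_n.+1) :=
  A k `<=` \bigcup_j box (q j) /\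
  \sum_(j <oo) v (q j) <= Leb (A k) + (e%:num / (2 ^ k.+1)%:R)%:E.
have [G PG] : {G & forall k, P k (G k)}.
  apply: (@choice _ _ P) => k; rewrite /P.
  pose S := [set \sum_(j <oo) v (q j)
            | q in [set q | A k `<=` \bigcup_j box (q j)]].
  have LebS : Leb (A k) = ereal_inf S by [].
  rewrite LebS; move infS : (ereal_inf S) => iS.
  case: iS infS => [r Sr|Soo|Soo].
  - have ek : (0 < e%:num / (2 ^ k.+1)%:R)%R by [].
    have /(lb_ereal_inf_adherent ek) : ereal_inf S \is a fin_num by rewrite Sr.
    move=> [x [q Akq vqx] xS].
    by exists q; split => //; rewrite vqx -Sr; exact/ltW.
  - by have := Aoo k; rewrite LebS Soo.
  - suff : lbound S 0 by move/le_ereal_inf_tmp; rewrite Soo.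
    by move=> /= _ [q _ <-]; exact: nneseries_ge0.
have vG_ge0 x : 0 <= (v \o uncurry G) x by exact: v_ge0.
apply: (@le_trans _ _ (\esum_(i in setT) (v \o uncurry G) i)).
  apply: ereal_inf_lbound => /=.
  have /card_esym/ppcard_eqP[f] := card_nat2.
  exists (uncurry G \o f).
    move=> t [i _] /((PG i).1) [j _ Gijt].
    by exists (f^-1%FUN (i, j)) => //=; rewrite invK ?inE.
  rewrite -(esum_pred_image (v \o uncurry G) _ xpredT) ?[fun=> _]set_true//.
  by rewrite image_eq.
rewrite (_ : esum _ _ = \sum_(i <oo) \sum_(j <oo) v (G i j)); last first.
  pose J : nat -> set (nat * nat) := fun i => [set (i, j) | j in setT].
  rewrite (_ : setT = \bigcup_k J k); last first.
    by rewrite predeqE => -[a b]; split => // _; exists a => //; exists b.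
  rewrite esum_bigcupT /=; last 2 first.
  - apply/trivIsetP => i j _ _ ij.
    rewrite predeqE => -[k m] /=; split => //= -[] [_] _ [<-{k} _].
    by move=> [m' _] [] /esym/eqP; rewrite (negbTE ij).
  - by move=> /= [k m]; exact: v_ge0.
  rewrite -(image_id [set: nat]) -fun_true esum_pred_image//; last first.
    by move=> k _; exact: esum_ge0.
  apply: eq_eseriesr => /= j _.
  rewrite -(esum_pred_image (v \o uncurry G) (pair j) predT)//=; last first.
    by move=> ? ? _ _; exact: (@can_inj _ _ _ snd).
  by congr esum; rewrite predeqE => -[a b]; split; move=> [i _ <-]; exists i.
apply: lee_nneseries => k *; last exact: (PG k).2.
by apply: nneseries_ge0 => *; exact: v_ge0.
Qed.

HB.instance Definition _ := isOuterMeasure.Build R 'rV[R]_n.+1 Leb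
  Leb0 Leb_ge0 le_Leb Leb_sigma_subadditive.

End lebesgue_outer_measure.

Section median_oscillation.
Context {R : realType} {n : nat}.
Implicit Types (Q : set 'rV[R]_n.+1) (f g : 'rV[R]_n.+1 -> R).
Implicit Types (s t : R) (phi : R -> R).

Definition is_cube Q : Prop := exists (a : 'rV[R]_n.+1) (l : R),
  0 < l /\ Q = [set x | forall i, a ord0 i <= x ord0 i <= a ord0 i + l].

(* |Q| as a real number, for Q of finite measure. *)
Definition vol Q : R := fine (Leb Q).

Definition Leb_measurable_fun Q f : Prop :=
  measurable_fun (Q : set (caratheodory_type (@Leb R n)))
                 (f : caratheodory_type (@Leb R n) -> R).

(* For g measurable on a cube Q and 0 < t < 1, the set below is nonempty and
   bounded above. *)
Definition max_median g t Q : R :=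
  sup [set M : R | (Leb (Q `&` [set y | (g y < M)%R]) <= t%:E * Leb Q)%E].

Definition bmo_norm s phi Q f : \bar R :=
  ereal_sup [set ereal_inf [set
      (max_median (fun y => `|f y - c|) (1 - s) Q' / phi (vol Q'))%:E
      | c in [set: R]]
    | Q' in [set Q' | is_cube Q' /\ Q' `<=` Q]].

Definition bmo s phi Q f : Prop :=
  Leb_measurable_fun Q f /\ (bmo_norm s phi Q f < +oo)%E.

End median_oscillation.

Section Psi.
Context {R : realType}.
Implicit Types (phi : R -> R) (d : nat) (V u y : R).

(* [Psi d phi V] is the function Psi_{|Q|} for a cube Q of R^d with |Q| = V. *)
Definition Psi d phi V u : \bar R :=
  (\int[lebesgue_measure]_(v in `[u, (2 ^+ d * V)%R]) (phi v / v)%:E)%E.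

Definition Psi_inv d phi V y : R :=
  if (lim (Psi d phi V u @[u --> 0%R^'+]) <= y%:E)%E then 0
  else xget 0 [set u | 0 < u <= 2 ^+ d * V /\ Psi d phi V u = y%:E].

End Psi.

(* Main.v *)
(* To every subcube P of Q attach a center c P such that |f - c P| < M on more than
   the fraction 1 - s of P. As s <= 2^-d, the centers of a dyadic cube and of its
   parent differ by at most 6 M. Stop at the maximal dyadic subcubes P with
   |c P - c Q| > 8 i M, for i up to L = 2^(d+1): every point stopped at the last
   threshold is stopped at all of them, and on half of each cube stopped at the i-th
   one, |f - c Q| is comparable to 8 i M, so a pigeonhole over i bounds the volume
   of the last stopped set by 2^-d |Q|. Off this set |f - c Q| <= (8 L + 1) M almost
   everywhere. Iterating inside the stopped cubes gives, with N > ||f||,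
     |{y in Q : |f - c Q| > A N sum_(j < k) phi(2^-dj |Q|)}| <= 2^-dk |Q|,
   and the sum is at most Psi (2^-d(k-1) |Q|) / (1 - 2^-d). *)
Require Import Defs.
From HB Require Import structures.
From mathcomp Require Import all_boot all_order all_algebra.
From mathcomp Require Import all_classical all_reals all_analysis.
From mathcomp Require Import ring lra measurable_realfun.
Set Implicit Arguments.
Unset Strict Implicit.
Unset Printing Implicit Defensive.
Import Order.TTheory GRing.Theory Num.Theory.
Import numFieldNormedType.Exports.
Local Open Scope classical_set_scope.
Local Open Scope ring_scope.

(** At [s = 2^-d] the near set of a child [P'], of volume above [(1 - s) |P'|], can fit in the part
    of the parent [P], below [s |P|], left free by the near set of [P]: two cubes alone give no
    contradiction. A third cube between them, found by the intermediate value theorem, makes the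
    count work. A single stopping threshold fails for a similar reason: it bounds the stopped volume
    only by [s / (1 - s) |Q|], which exceeds [2^-d |Q|] at the endpoint, whereas the ratio [2^-d] is
    what matches the halving of the side in each round. The [L] thresholds repair this at the price
    of a constant. Since the infimum over [c] need not be attained, a number [N] above the norm is
    used: twice the norm if it is positive, any [N > 0] if it is zero. *)

Section real_auxiliaries.
Context {R : realType}.
Implicit Types x y lo hi : R.

Lemma exists_div_pow_lt (r x e : R) : 1 < r -> 0 < e -> exists k, x / r ^+ k < e.
Proof.
move=> r1 e0; have r0 : 0 < r by exact: lt_trans r1.
have : (fun k => x / r ^+ k) @ \oo --> (x * 0).
  under eq_cvg do rewrite -exprVn; apply: cvgMr.
  by apply: cvg_expr; rewrite gtr0_norm ?invf_lt1 ?invr_gt0.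
rewrite mulr0 => /cvgr_lt/(_ _ e0)[k _ ke].
by exists k; exact: ke (leqnn k).
Qed.

(** Prepares two uses of the intermediate value theorem, for a volume and for an integral of which
    only the increments are controlled. *)
Lemma dominated_continuous (g w : R -> R) :
  (forall x y, `|g x - g y| <= `|w x - w y|) -> continuous w -> continuous g.
Proof.
move=> gw cw x; apply/cvgrPdist_lt => eps eps0.
have /cvgrPdist_lt/(_ _ eps0) := cw x.
by apply: filterS => y; exact: le_lt_trans.
Qed.

(* Extends to the whole line the continuity of a function given on [lo, hi]. *)
Definition clamp lo hi x : R := Num.max lo (Num.min x hi).

Lemma clamp_in lo hi x : lo <= hi -> lo <= clamp lo hi x <= hi.
Proof. by move=> lohi; rewrite /clamp le_max lexx/= ge_max lohi ge_min lexx orbT. Qed.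

Lemma clamp_id lo hi x : lo <= x <= hi -> clamp lo hi x = x.
Proof. by move=> /andP[lox xhi]; rewrite /clamp (min_idPl xhi) (max_idPr lox). Qed.

Lemma clamp_continuous lo hi : continuous (clamp lo hi).
Proof.
move=> x; apply: (@continuous_max R R (fun=> lo) (fun x => Num.min x hi) x).
  exact: cvg_cst.
by apply: (@continuous_min R R id (fun=> hi) x); [exact: cvg_id|exact: cvg_cst].
Qed.

Lemma le_half_of_le_pow n (s : R) : s <= 1 / 2 ^+ n.+1 -> s <= 1 / 2.
Proof.
move=> s_le; apply: le_trans s_le _; rewrite ler_pM2l// lef_pV2 ?posrE ?exprn_gt0//.
by rewrite exprS ler_peMr// exprn_ege1// ler1n.
Qed.

End real_auxiliaries.

(** * Boxes and their overlap with cubes *)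

Section boxes.
Context {R : realType} {n : nat}.
Implicit Types (a b x : 'rV[R]_n.+1) (l r : R) (e : {ffun 'I_n.+1 -> bool}).
Implicit Types (p q : 'rV[R]_n.+1 * 'rV[R]_n.+1).

Definition cube a l : set 'rV[R]_n.+1 :=
  [set x | forall i, a ord0 i <= x ord0 i <= a ord0 i + l].

Lemma cubeE a l : cube a l = box (a, a + const_mx l).
Proof.
by apply/seteqP; split => x + i => /(_ i); rewrite /= !mxE.
Qed.

(* The children of a cube are indexed by the coordinates in which their corner
   is shifted by half the side. *)
Definition child_corner a l e : 'rV[R]_n.+1 :=
  \row_i (a ord0 i + (if e i then l / 2 else 0)).

Definition enlarge p (h : R) : 'rV[R]_n.+1 * 'rV[R]_n.+1 :=
  (p.1 - const_mx h, p.2 + const_mx h).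

(** Small cubes that meet a box lie in the enlarged box; continuity of the volume at [h = 0] keeps
    the cost below [eps]. *)
Lemma box_volume_enlarge p (eps : R) : 0 < eps ->
  exists2 h, 0 < h & box_volume (enlarge p h) <= box_volume p + eps.
Proof.
move=> e0.
have c : {for 0, continuous (fun h => box_volume (enlarge p h))}.
  rewrite (_ : (fun h => _) = fun h => \prod_(i < n.+1)
      Num.max 0 ((p.2 ord0 i + h) - (p.1 ord0 i - h))); last first.
    by apply/funext => h; apply: eq_bigr => i _; rewrite !mxE.
  apply: (@continuous_big R _ _ _ _ mul_continuous R) => i _ x.
  apply: (@continuous_max R R (fun=> 0) (fun h => (p.2 ord0 i + h) - (p.1 ord0 i - h)) x).
    exact: cvg_cst.
  apply: cvgB; first by apply: cvgD; [exact: cvg_cst|exact: cvg_id].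
  by apply: cvgB; [exact: cvg_cst|exact: cvg_id].
have e0p : enlarge p 0 = p.
  case: p {c} => u v; rewrite /enlarge/=; congr (_, _);
  by apply/rowP => i; rewrite !mxE ?subr0 ?addr0.
near (0 : R)^'+ => h; exists h; first by near: h; exact: nbhs_right_gt.
near: h; move/cvg_at_right_filter : c => /cvgr_le; apply.
by rewrite e0p ltrDl.
Unshelve. all: by end_near. Qed.

(** * Lebesgue measure of cubes *)

Lemma Leb_cover (A : set 'rV[R]_n.+1)
    (p : nat -> 'rV[R]_n.+1 * 'rV[R]_n.+1) : A `<=` \bigcup_k box (p k) ->
  (Leb A <= \sum_(k <oo) (box_volume (p k))%:E)%E.
Proof. by move=> Ap; apply: ereal_inf_lbound; exists p. Qed.

Lemma Leb_box p : (Leb (box p) <= (box_volume p)%:E)%E.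
Proof.
apply: le_trans (@Leb_cover _ (fun k => if k is 0%N then p else (0, 0)) _) _.
  by move=> x px; exists 0%N.
rewrite (nneseries_split 0 1)//; last by move=> k _; rewrite lee_fin box_volume_ge0.
rewrite big_mkord big_ord1 eseries0 ?adde0// => -[//|k] _ _.
by rewrite box_volume0.
Qed.

(** The volume of the intersection of the box [q] with [cube a l]; the truncation gives 0 when they
    are disjoint. *)
Definition cap_volume q a l : R :=
  \prod_(i < n.+1) Num.max 0
     (Num.min (q.2 ord0 i) (a ord0 i + l) - Num.max (q.1 ord0 i) (a ord0 i)).

Lemma cap_volume_ge0 q a l : 0 <= cap_volume q a l.
Proof. by apply: prodr_ge0 => i _; rewrite le_max lexx. Qed.

Lemma cap_volume_le q a l : cap_volume q a l <= box_volume q.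
Proof.
apply: ler_prod => i _; rewrite le_max lexx/= ge_max le_max lexx/= le_max.
by apply/orP; right; apply: lerB; rewrite ?ge_min ?le_max lexx.
Qed.

Lemma cap_volume_sub q a l : 0 <= l -> cube a l `<=` box q ->
  cap_volume q a l = l ^+ n.+1.
Proof.
move=> l0 aq; rewrite /cap_volume.
have aa : cube a l a by move=> i; rewrite lexx/= lerDl.
have al : cube a l (a + const_mx l) by move=> i; rewrite !mxE lexx lerDl l0.
rewrite -[in RHS](card_ord n.+1) -prodr_const; apply: eq_bigr => i _.
have /andP[h1 _] := aq _ aa i; have /andP[_] := aq _ al i.
rewrite !mxE => h2.
by rewrite (min_idPr h2) (max_idPr h1) addrAC subrr add0r (max_idPr l0).
Qed.

(** In each coordinate the overlaps with the two halves add up to at most the overlap with the whole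
    side; expanding the product of these two-term sums gives one term per child. *)
Lemma cap_volume_split q a l : 0 <= l ->
  \sum_e cap_volume q (child_corner a l e) (l / 2) <= cap_volume q a l.
Proof.
move=> l0; pose F i (b : bool) : R :=
  let c := a ord0 i + (if b then l / 2 else 0) in
  Num.max 0 (Num.min (q.2 ord0 i) (c + l / 2) - Num.max (q.1 ord0 i) c).
rewrite (eq_bigr (fun e : {ffun 'I_n.+1 -> bool} => \prod_i F i (e i))); last first.
  by move=> e _; apply: eq_bigr => i _; rewrite !mxE.
rewrite -(bigA_distr_bigA F).
apply: ler_prod => i _; rewrite sumr_ge0/=; last first.
  by move=> b _; rewrite le_max lexx.
rewrite big_bool /F /= addr0.
rewrite /Num.max /Num.min; repeat case: ifPn; rewrite -?leNgt; lra.
Qed.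

End boxes.

Section cube_volume.
Context {R : realType} {n : nat}.
Implicit Types (a b x : 'rV[R]_n.+1) (l r : R) (e : {ffun 'I_n.+1 -> bool}).
Implicit Types (p : 'rV[R]_n.+1 * 'rV[R]_n.+1).
Implicit Types (q : nat -> 'rV[R]_n.+1 * 'rV[R]_n.+1).

(* A cover of a cube by boxes of too small total volume also undercovers one of
   its children; iterating, the nested cubes shrink to a point, which lies in the
   interior of a single (enlarged) box, and this is absurd. *)
Lemma undercovered_child q a l : 0 < l ->
  (\sum_(k <oo) (cap_volume (q k) a l)%:E < (l ^+ n.+1)%:E)%E ->
  exists e, (\sum_(k <oo) (cap_volume (q k) (child_corner a l e) (l / 2))%:E
             < ((l / 2) ^+ n.+1)%:E)%E.
Proof.
move=> l0; apply: contraPP => /forallNP H; apply/negP; rewrite -leNgt.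
apply: (@le_trans _ _ (\sum_(k <oo)
    \sum_e (cap_volume (q k) (child_corner a l e) (l / 2))%:E)%E); last first.
  apply: lee_nneseries => [k _ _|k _].
    by apply: sume_ge0 => e _; rewrite lee_fin cap_volume_ge0.
  by rewrite sumEFin lee_fin cap_volume_split// ltW.
rewrite nneseries_sum; last by move=> e k _; rewrite lee_fin cap_volume_ge0.
apply: (@le_trans _ _ (\sum_(e : {ffun 'I_n.+1 -> bool}) ((l / 2) ^+ n.+1)%:E)%E).
  rewrite sumEFin lee_fin sumr_const card_ffun card_bool card_ord.
  by rewrite -[in leRHS](mulr_natl (_ ^+ _)) natrX -exprMn mulrCA divff// mulr1.
by apply: lee_sum => e _; rewrite leNgt; apply/negP/H.
Qed.

Lemma Leb_cube_ge a l : 0 < l -> ((l ^+ n.+1)%:E <= Leb (cube a l))%E.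
Proof.
move=> l0; apply: le_ereal_inf_tmp => _ [q aq <-].
apply/lee_addgt0Pr => eps eps0.
have /choice[h qh] : forall k, exists h, 0 < h /\
    box_volume (enlarge (q k) h) <= box_volume (q k) + eps / (2 ^ k.+1)%:R.
  by move=> k; have [|h h0 hv] := @box_volume_enlarge R n (q k) (eps / (2 ^ k.+1)%:R);
    [rewrite divr_gt0// ltr0n expn_gt0|exists h].
pose q' k := enlarge (q k) (h k).
apply: (@le_trans _ _ (\sum_(k <oo) (box_volume (q' k))%:E)%E); last first.
  apply: le_trans (epsilon_trick xpredT _ (ltW eps0)); last first.
    by move=> k; rewrite lee_fin box_volume_ge0.
  apply: lee_nneseries => [k _ _|k _]; first by rewrite lee_fin box_volume_ge0.
  by rewrite -EFinD lee_fin; exact: (qh k).2.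
rewrite leNgt; apply/negP => lt.
pose P (u : 'rV[R]_n.+1 * R) :=
  0 < u.2 /\ (\sum_(k <oo) (cap_volume (q' k) u.1 u.2)%:E < (u.2 ^+ n.+1)%:E)%E.
have P0 : P (a, l).
  split => //=; apply: le_lt_trans lt; apply: lee_nneseries => [k _ _|k _].
    by rewrite lee_fin cap_volume_ge0.
  by rewrite lee_fin cap_volume_le.
have /choice[g Pg] : forall u, exists e, P u -> P (child_corner u.1 u.2 e, u.2 / 2).
  move=> u; have [[u0 /(undercovered_child u0)[e ue]]|nP] := pselect (P u).
    by exists e => _; split => //=; rewrite divr_gt0.
  by exists [ffun=> false].
pose N := fix N k := if k is k'.+1 then
  (child_corner (N k').1 (N k').2 (g (N k')), (N k').2 / 2) else (a, l).
have PN k : P (N k) by elim: k => //= k /Pg.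
have N2 k : (N k).2 = l / 2 ^+ k.
  by elim: k => /= [|k ->]; rewrite ?divr1// exprSr invfM mulrA.
have Nle i k : (N k).1 ord0 i <= (N k.+1).1 ord0 i /\
    (N k.+1).1 ord0 i + (N k.+1).2 <= (N k).1 ord0 i + (N k).2.
  have := (PN k).1; rewrite /= !mxE; case: ifP => _ ?; split; lra.
have N1 i : nondecreasing_seq (fun k => (N k).1 ord0 i).
  by apply/nondecreasing_seqP => k; exact: (Nle i k).1.
have N1' i : nonincreasing_seq (fun k => (N k).1 ord0 i + (N k).2).
  by apply/nonincreasing_seqP => k; exact: (Nle i k).2.
have N12 i j k : (N j).1 ord0 i <= (N k).1 ord0 i + (N k).2.
  apply: le_trans (N1 i j (maxn j k) (leq_maxl _ _)) _.
  apply: le_trans (N1' i k (maxn j k) (leq_maxr _ _)).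
  by rewrite lerDl; exact/ltW/(PN _).1.
pose x : 'rV[R]_n.+1 := \row_i sup [set (N k).1 ord0 i | k in setT].
have xN k : cube (N k).1 (N k).2 x.
  move=> i; rewrite mxE; apply/andP; split.
    apply: ub_le_sup; last by exists k.
    by exists ((N 0%N).1 ord0 i + (N 0%N).2) => _ [j _ <-].
  by apply: ge_sup; [exists ((N 0%N).1 ord0 i), 0%N|move=> _ [j _ <-]].
(* The common point [x] of the nested cubes lies in an original box [q k]; a nested cube of side
   below [h k] is then contained in [q' k], whose term alone is the full volume of that cube. *)
have [k _ xk] := aq x (xN 0%N).
have [m lm] := exists_div_pow_lt l (ltr1n R 2) (qh k).1.
have [Nm] := PN m; apply/negP; rewrite -leNgt.
apply: (@le_trans _ _ (cap_volume (q' k) (N m).1 (N m).2)%:E).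
  rewrite lee_fin cap_volume_sub//; first exact/ltW/(PN m).1.
  move=> y ym i; rewrite !mxE.
  have /andP[y1 y2] := ym i; have /andP[x1 x2] := xN m i.
  have /andP[] := xk i; move: lm; rewrite -N2 => *; apply/andP; split; lra.
rewrite (nneseries_split 0 k.+1)//; last by move=> j _; rewrite lee_fin cap_volume_ge0.
rewrite big_mkord big_ord_recr/= -addeA addeCA leeDl// adde_ge0//.
  by apply: sume_ge0 => j _; rewrite lee_fin cap_volume_ge0.
by apply: nneseries_ge0 => j _ _; rewrite lee_fin cap_volume_ge0.
Qed.

Lemma Leb_cube a l : 0 < l -> Leb (cube a l) = (l ^+ n.+1)%:E.
Proof.
move=> l0; apply/eqP; rewrite eq_le Leb_cube_ge// andbT cubeE.
apply: le_trans (Leb_box _) _; rewrite lee_fin /box_volume /=.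
rewrite (eq_bigr (fun=> l)) ?prodr_const ?card_ord// => i _.
by rewrite !mxE addrAC subrr add0r (max_idPr (ltW l0)).
Qed.

End cube_volume.

(** * Caratheodory measurability of half-spaces and cubes *)

Section measurability.
Context {R : realType} {n : nat}.
Local Notation T := 'rV[R]_n.+1.
Local Notation LebM := (@Leb R n).-cara.-measurable.
Implicit Types (a b x : T) (l r : R) (e : {ffun 'I_n.+1 -> bool}) (X Y : set T).
Implicit Types (p : T * T).

Lemma box_volume_cut p (i : 'I_n.+1) (c : R) :
  box_volume (p.1, \row_j (if j == i then Num.min (p.2 ord0 j) c else p.2 ord0 j)) +
  box_volume (\row_j (if j == i then Num.max (p.1 ord0 j) c else p.1 ord0 j), p.2)
  = box_volume p.
Proof.
rewrite /box_volume (bigD1 i)//= [X in _ + X](bigD1 i)//= [RHS](bigD1 i)//= !mxE eqxx.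
rewrite [X in _ * X + _](eq_bigr (fun j => Num.max 0 (p.2 ord0 j - p.1 ord0 j))); last first.
  by move=> j /negPf ji; rewrite !mxE ji.
rewrite [X in _ + _ * X](eq_bigr (fun j => Num.max 0 (p.2 ord0 j - p.1 ord0 j))); last first.
  by move=> j /negPf ji; rewrite !mxE ji.
rewrite -mulrDl; congr (_ * _).
rewrite /Num.max /Num.min; repeat case: ifPn; rewrite -?leNgt; lra.
Qed.

(** Cutting every box of a cover of [X] by the hyperplane gives covers of the two parts of [X] with
    the same total volume. *)
Lemma halfspace_le_measurable (i : 'I_n.+1) (c : R) :
  LebM ([set x : T | x ord0 i <= c] : set T).
Proof.
apply: le_caratheodory_measurable => X; apply: le_ereal_inf_tmp => _ [q Xq <-].
pose q1 k : T * T :=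
  ((q k).1, \row_j (if j == i then Num.min ((q k).2 ord0 j) c else (q k).2 ord0 j)).
pose q2 k : T * T :=
  (\row_j (if j == i then Num.max ((q k).1 ord0 j) c else (q k).1 ord0 j), (q k).2).
apply: (@le_trans _ _ (\sum_(k <oo) (box_volume (q1 k))%:E +
                       \sum_(k <oo) (box_volume (q2 k))%:E)%E).
  apply: leeD; apply: Leb_cover => x [/= /Xq[k _ qx] xi]; exists k => // j;
    have /andP[h1 h2] := qx j; rewrite !mxE /=; case: eqP => [ji|]; rewrite ?h1 ?h2//=.
    by rewrite le_min h2 ji xi.
  by rewrite ge_max h1 ji andbT/= ltW// ltNge; exact/negP.
rewrite -nneseriesD; try by move=> k _ _; rewrite lee_fin box_volume_ge0.
by under eq_eseriesr do rewrite -EFinD box_volume_cut.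
Qed.

Lemma halfspace_ge_measurable (i : 'I_n.+1) (c : R) :
  LebM ([set x : T | c <= x ord0 i] : set T).
Proof.
rewrite (_ : [set x | _] = \bigcap_k [set x : T | c - k.+1%:R^-1 < x ord0 i]).
  apply: bigcapT_measurable => k.
  rewrite (_ : [set x | _] = ~` [set x : T | x ord0 i <= c - k.+1%:R^-1]).
    exact/measurableC/halfspace_le_measurable.
  by apply/seteqP; split => x /=; rewrite ltNge => /negP.
apply/seteqP; split => x /= => [cx k _ /=|h].
  by apply: lt_le_trans cx; rewrite ltrBlDr ltrDl.
apply/ler_addgt0Pr => eps eps0.
have [k ke] : exists k, x ord0 i + k.+1%:R^-1 < x ord0 i + eps.
  by apply: ltr_add_invr; rewrite ltrDl.
have := h k I => /=; move: ke; set u := _^-1; lra.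
Qed.

Definition Leb_measure : {measure set (caratheodory_type (@Leb R n)) -> \bar R} :=
  let mu : {outer_measure set T -> \bar R} := @Leb R n in
  (mu : set (caratheodory_type mu) -> \bar R).

(** Half-open, so that the children partition their parent; the closed cube differs from it by a
    null set. *)
Definition hcube a l : set T :=
  [set x | forall i, a ord0 i <= x ord0 i < a ord0 i + l].

Lemma hcube_sub_cube a l : hcube a l `<=` cube a l.
Proof. by move=> x h i; have /andP[-> /ltW] := h i. Qed.

Lemma cube_measurable a l : LebM (cube a l).
Proof.
rewrite (_ : cube a l = \bigcap_(i in [set: 'I_n.+1])
  ([set x : T | a ord0 i <= x ord0 i] `&` [set x | x ord0 i <= a ord0 i + l])).
  apply: fin_bigcap_measurable => // i _; apply: measurableI.
    exact: halfspace_ge_measurable.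
  exact: halfspace_le_measurable.
apply/seteqP; split => x h i => [_|]; first by have /andP[] := h i.
by have [/= -> ->] := h i I.
Qed.

Lemma hcube_measurable a l : LebM (hcube a l).
Proof.
rewrite (_ : hcube a l = \bigcap_(i in [set: 'I_n.+1])
  ([set x : T | a ord0 i <= x ord0 i] `&` ~` [set x | a ord0 i + l <= x ord0 i])).
  apply: fin_bigcap_measurable => // i _; apply: measurableI.
    exact: halfspace_ge_measurable.
  exact/measurableC/halfspace_ge_measurable.
apply/seteqP; split => x h i => [_|].
  by have /andP[h1 h2] := h i; split => //=; apply/negP; rewrite -ltNge.
by have [/= -> /negP] := h i I; rewrite -ltNge.
Qed.

Lemma Leb_hcube a l : 0 < l -> Leb (hcube a l) = (l ^+ n.+1)%:E.
Proof.
move=> l0; apply/eqP; rewrite eq_le -{1}(Leb_cube a l0) le_Leb/=; last first.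
  exact: hcube_sub_cube.
have h r : 0 < r < l -> ((r ^+ n.+1)%:E <= Leb (hcube a l))%E.
  move=> /andP[r0 rl]; rewrite -(Leb_cube a r0) le_Leb// => x h i.
  by have /andP[-> /le_lt_trans -> //] := h i; rewrite ltrD2l.
have fin : Leb (hcube a l) \is a fin_num.
  rewrite ge0_fin_numE ?Leb_ge0//.
  by rewrite (le_lt_trans (le_Leb (@hcube_sub_cube a l)))// Leb_cube// ltry.
rewrite -(fineK fin) lee_fin.
have : (fun r : R => r ^+ n.+1) r @[r --> l^'-] --> l ^+ n.+1.
  exact/cvg_at_left_filter/exprn_continuous.
move=> cv; rewrite -(cvg_lim _ cv)//; apply: limr_le; first by apply/cvg_ex; eexists; exact: cv.
near=> r; rewrite -lee_fin fineK// h//; apply/andP; split.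
  by near: r; exact: nbhs_left_gt.
by near: r; exact: nbhs_left_lt.
Unshelve. all: by end_near. Qed.

Lemma Leb_cubeD_hcube a l : 0 < l -> Leb (cube a l `\` hcube a l) = 0.
Proof.
move=> l0; have : Leb (cube a l) =
    (Leb (cube a l `&` hcube a l) + Leb (cube a l `&` ~` hcube a l))%E.
  exact: hcube_measurable.
rewrite (setIidr (@hcube_sub_cube a l)) Leb_hcube// Leb_cube// setDE.
case: (Leb _) (Leb_ge0 (cube a l `&` ~` hcube a l)) => // r _.
by rewrite -EFinD => -[/eqP]; rewrite addrC -subr_eq subrr => /eqP <-.
Qed.

End measurability.

(** * Dyadic cubes and stopping *)

Section dyadic_tree.
Context {R : realType} {n : nat}.
Local Notation T := 'rV[R]_n.+1.
Local Notation E := {ffun 'I_n.+1 -> bool}.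
Local Notation LebM := (@Leb R n).-cara.-measurable.
Implicit Types (a b x : T) (l r : R) (e : E) (X Y : set T).
Implicit Types (p : T * T).

Section countable_family.
Variables (I : countType) (F : I -> set T) (X : set T) (theta : R).
Hypotheses (mF : forall i, LebM (F i)) (tF : trivIset setT F) (theta0 : 0 <= theta).

Let G (k : nat) : set T := if pickle_inv k is Some i then F i else set0.

Let G_bigcup : \bigcup_k G k = \bigcup_i F i.
Proof.
apply/seteqP; split => x [k _]; rewrite /G.
  by case: pickle_inv => // i Fi; exists i.
by move=> Fx; exists (pickle k) => //; rewrite pickleK_inv.
Qed.

Let G_triv : trivIset setT G.
Proof.
move=> j k _ _; rewrite /G => -[x []].
have := @pickle_invK I j; have := @pickle_invK I k.
case: (pickle_inv k) => // u <-; case: (pickle_inv j) => // v <- vx ux.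
by congr pickle; apply: tF => //; exists x.
Qed.

Let G_meas k : LebM (G k).
Proof. by rewrite /G; case: pickle_inv => // i; exact: mF. Qed.

Let LebG : Leb (\bigcup_k G k) = (\sum_(k <oo) Leb (G k))%E.
Proof.
have := measure_bigcup Leb_measure setT G (fun k _ => G_meas k) G_triv.
by under eq_eseriesl do rewrite in_setT.
Qed.

Lemma Leb_family_le : (forall i, Leb (X `&` F i) <= theta%:E * Leb (F i))%E ->
  (Leb (X `&` \bigcup_i F i) <= theta%:E * Leb (\bigcup_i F i))%E.
Proof.
move=> XF; rewrite -G_bigcup; apply: le_trans (outer_measure_bigcup_lim _ _ _) _.
rewrite LebG -nneseriesZl//; last by move=> k _; exact: Leb_ge0.
apply: lee_nneseries => k _; first by move=> _; exact: Leb_ge0.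
rewrite -[_ (X `&` _)]/(Leb (X `&` _)) /G.
by case: pickle_inv => [i|]; rewrite ?setI0 ?Leb0 ?mule0.
Qed.

(** The pieces of the arbitrary set [X] must add up from below, which is the countable form of
    Caratheodory's criterion for the [F i]. *)
Lemma Leb_family_ge : (forall i, theta%:E * Leb (F i) <= Leb (X `&` F i))%E ->
  (theta%:E * Leb (\bigcup_i F i) <= Leb (X `&` \bigcup_i F i))%E.
Proof.
move=> XF; rewrite -G_bigcup.
have := @caratheodory_lime_le R T (@Leb R n) G G_meas G_triv (X `&` \bigcup_k G k).
apply: le_trans; rewrite LebG -nneseriesZl//; last by move=> k _; exact: Leb_ge0.
rewrite -[leLHS]adde0 leeD ?Leb_ge0//; apply: lee_nneseries => [k _ _|k _].
  by rewrite mule_ge0 ?Leb_ge0.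
rewrite -[_ (_ `&` G k)]/(Leb (_ `&` _)) -setIA (setIidr (bigcup_sup _))//.
by rewrite /G; case: pickle_inv => [i|]; rewrite ?setI0 ?Leb0 ?mule0.
Qed.

End countable_family.

(** The word is read from the root down: prefixes of [s] are ancestors, appended letters lead to
    descendants. *)
Fixpoint node a l (s : seq E) : T * R :=
  if s is e :: s' then node (child_corner a l e) (l / 2) s' else (a, l).

Definition node_hcube a l s := hcube (node a l s).1 (node a l s).2.
Definition node_cube a l s := cube (node a l s).1 (node a l s).2.

Lemma node_cat a l s s' :
  node a l (s ++ s') = node (node a l s).1 (node a l s).2 s'.
Proof. by elim: s a l => //= e s IH a l; rewrite IH. Qed.

Lemma node_side a l s : (node a l s).2 = l / 2 ^+ size s.
Proof.
elim: s a l => [|e s IH] a l /=; first by rewrite divr1.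
by rewrite IH exprS invfM mulrA.
Qed.

Lemma node_side_gt0 a l s : 0 < l -> 0 < (node a l s).2.
Proof. by move=> l0; rewrite node_side divr_gt0 ?exprn_gt0. Qed.

Lemma child_cube_sub a l e : 0 < l -> cube (child_corner a l e) (l / 2) `<=` cube a l.
Proof. by move=> l0 x h i; have := h i; rewrite !mxE; case: ifP => _; lra. Qed.

Lemma child_hcube_sub a l e : 0 < l -> hcube (child_corner a l e) (l / 2) `<=` hcube a l.
Proof. by move=> l0 x h i; have := h i; rewrite !mxE; case: ifP => _; lra. Qed.

Lemma node_hcube_sub a l s : 0 < l -> node_hcube a l s `<=` hcube a l.
Proof.
rewrite /node_hcube.
elim: s a l => [|e s IH] a l l0 /=; first exact: subset_refl.
have l20 : 0 < l / 2 by rewrite divr_gt0.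
by move=> x /(IH _ _ l20); exact: child_hcube_sub.
Qed.

Lemma node_cube_sub a l s : 0 < l -> node_cube a l s `<=` cube a l.
Proof.
rewrite /node_cube.
elim: s a l => [|e s IH] a l l0 /=; first exact: subset_refl.
have l20 : 0 < l / 2 by rewrite divr_gt0.
by move=> x /(IH _ _ l20); exact: child_cube_sub.
Qed.

Lemma node_hcube_prefix a l s s' : 0 < l -> node_hcube a l (s ++ s') `<=` node_hcube a l s.
Proof.
by move=> l0; rewrite /node_hcube node_cat; apply/node_hcube_sub/node_side_gt0.
Qed.

Lemma node_hcube_cover a l m x : 0 < l -> hcube a l x ->
  exists2 s, size s = m & node_hcube a l s x.
Proof.
rewrite /node_hcube.
elim: m a l => [|m IH] a l l0 ax; first by exists [::].
pose e : E := [ffun i => a ord0 i + l / 2 <= x ord0 i].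
have [| |s sm sx] := IH (child_corner a l e) (l / 2); first by rewrite divr_gt0.
  by move=> i; have := ax i; rewrite !mxE ffunE; case: ifPn; rewrite -?ltNge => ?; lra.
by exists (e :: s) => //=; rewrite sm.
Qed.

Lemma node_hcube_inj a l x s s' : 0 < l -> size s = size s' ->
  node_hcube a l s x -> node_hcube a l s' x -> s = s'.
Proof.
rewrite /node_hcube.
elim: s s' a l => [[]//|e s IH [//|e' s'] a l l0 [ss] /= h h'].
have l20 : 0 < l / 2 by rewrite divr_gt0.
suff ee' : e = e' by congr cons => //; apply: IH h _ => //; rewrite ee'.
apply/ffunP => i; move: h => /(node_hcube_sub l20)/(_ i).
move: h' => /(node_hcube_sub l20)/(_ i); rewrite !mxE.
by case: (e i) (e' i) => [] [] //; lra.
Qed.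

End dyadic_tree.

(** * Null sets recognised by their density in dyadic cubes *)

Section density.
Context {R : realType} {n : nat}.
Local Notation T := 'rV[R]_n.+1.
Local Notation E := {ffun 'I_n.+1 -> bool}.
Local Notation LebM := (@Leb R n).-cara.-measurable.
Implicit Types (a b x : T) (l r : R) (e : E) (s : seq E) (X Y : set T).

Lemma Leb_fin X a l : 0 < l -> X `<=` cube a l -> Leb X \is a fin_num.
Proof.
move=> l0 Xa; rewrite ge0_fin_numE ?Leb_ge0//.
by rewrite (le_lt_trans (le_Leb Xa))// Leb_cube// ltry.
Qed.

(** The dyadic cubes of a generation of side below [h] that meet the box cover its part of [X] and
    stay in the box enlarged by [h]. *)
Lemma density_box X a l (theta : R) p : 0 < l -> 0 <= theta ->
  X `<=` hcube a l ->
  (forall s, Leb (X `&` node_hcube a l s) <= theta%:E * Leb (node_hcube a l s))%E ->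
  (Leb (X `&` box p) <= theta%:E * (box_volume p)%:E)%E.
Proof.
move=> l0 th0 Xa Xs.
suff H eps : 0 < eps ->
    (Leb (X `&` box p) <= theta%:E * (box_volume p + eps)%:E)%E.
  apply/lee_addgt0Pr => eps eps0.
  have th1 : 0 < theta + 1 by rewrite ltr_wpDl.
  apply: le_trans (H (eps / (theta + 1)) _) _; first by rewrite divr_gt0.
  rewrite -!EFinM -EFinD lee_fin mulrDr lerD2l mulrCA ger_pMr//.
  by rewrite ler_pdivrMr// mul1r lerDl.
move=> eps0; have [h h0 hv] := box_volume_enlarge p eps0.
have [m lm] := exists_div_pow_lt l (ltr1n R 2) h0.
pose F s : set T := [set x | [/\ size s = m, node_hcube a l s `&` box p !=set0 &
                                node_hcube a l s x]].
have FE s : F s = node_hcube a l s \/ F s = set0.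
  have [h'|h'] := pselect (size s = m /\ node_hcube a l s `&` box p !=set0).
    by left; apply/seteqP; split => x => [[]//|]; split => //; case: h'.
  by right; apply/seteqP; split => x // -[h1 h2 _]; case: h'.
apply: (@le_trans _ _ (Leb (X `&` \bigcup_s F s))).
  apply: le_Leb => x [Xx px]; split => //.
  have [s sm sx] := node_hcube_cover m l0 (Xa _ Xx).
  by exists s => //; split => //; exists x.
apply: le_trans (@Leb_family_le R n _ F X theta _ _ _) _.
- by move=> s; case: (FE s) => ->; [exact: hcube_measurable|exact: measurable0].
- move=> s s' _ _ [x [[sm _ sx] [sm' _ sx']]].
  by apply: node_hcube_inj l0 _ sx sx'; rewrite sm.
- by move=> s; case: (FE s) => -> //; rewrite setI0 Leb0 mule0.
apply: lee_wpmul2l; first by rewrite lee_fin.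
apply: (@le_trans _ _ (Leb (box (enlarge p h)))); last first.
  by apply: le_trans (Leb_box _) _; rewrite lee_fin.
apply: le_Leb => x [s _ [sm [y [ys yp]] xs]] i; rewrite !mxE.
have := xs i; have := ys i; have := yp i; rewrite node_side sm.
move: lm; set u := l / _; lra.
Qed.

(** Plays the part of Lebesgue's density theorem: summing the bound for boxes over a nearly optimal
    cover gives [Leb X <= theta * Leb X], with [Leb X] finite. *)
Lemma null_of_density X a l (theta : R) : 0 < l -> 0 <= theta -> theta < 1 ->
  X `<=` hcube a l ->
  (forall s, Leb (X `&` node_hcube a l s) <= theta%:E * Leb (node_hcube a l s))%E ->
  Leb X = 0.
Proof.
move=> l0 th0 th1 Xa Xs.
have Xf := Leb_fin l0 (subset_trans Xa (@hcube_sub_cube R n a l)).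
have : (Leb X <= theta%:E * Leb X)%E.
  apply/lee_addgt0Pr => eps eps0; have e0 : 0 < eps / (theta + 1).
    by rewrite divr_gt0// ltr_wpDl.
  have [_ [q Xq <-] qX] := lb_ereal_inf_adherent e0 Xf.
  apply: (@le_trans _ _ (theta%:E * (Leb X + (eps / (theta + 1))%:E))%E); last first.
    rewrite -(fineK Xf) -!(EFinM, EFinD) lee_fin mulrDr lerD2l mulrCA ger_pMr//.
    by rewrite ler_pdivrMr ?ltr_wpDl// mul1r lerDl.
  apply: le_trans (lee_wpmul2l _ (ltW qX)); last by rewrite lee_fin.
  rewrite -nneseriesZl//; last by move=> k _; rewrite lee_fin box_volume_ge0.
  apply: (@le_trans _ _ (Leb (X `&` \bigcup_k box (q k)))).
    by apply: le_Leb => x Xx; split => //; exact: Xq.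
  apply: le_trans (outer_measure_bigcup_lim _ _ _) _.
  apply: lee_nneseries => [k _ _|k _]; first exact: Leb_ge0.
  exact: (density_box (q k) l0 th0 Xa Xs).
rewrite -(fineK Xf) -EFinM lee_fin => XX.
have : 0 <= fine (Leb X) by rewrite fine_ge0// Leb_ge0.
by rewrite le_eqVlt => /orP[/eqP<-//|X0]; move: XX; rewrite ler_pMl// leNgt th1.
Qed.

(** * Maximal dyadic subcubes with a given property *)

Section stopping.
Variables (bad : set T -> Prop) (a : T) (l : R).
Hypothesis l0 : 0 < l.

Definition reached : set T := [set x | exists2 s, node_hcube a l s x & bad (node_cube a l s)].

Definition stopped s := bad (node_cube a l s) /\
  forall j, (j < size s)%N -> ~ bad (node_cube a l (take j s)).

(** Empty unless [s] is stopped, so that the cells are indexed by the countable type of all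
    words. *)
Definition stop_cell s : set T := [set x | stopped s /\ node_hcube a l s x].

Lemma stop_cellE s : stopped s -> stop_cell s = node_hcube a l s.
Proof. by move=> ss; apply/seteqP; split => x // -[]. Qed.

Lemma stop_cell0 s : ~ stopped s -> stop_cell s = set0.
Proof. by move=> ss; apply/seteqP; split => x // -[]. Qed.

Lemma stop_cell_measurable s : LebM (stop_cell s).
Proof.
have [/stop_cellE ->|/stop_cell0 ->] := pselect (stopped s).
  exact: hcube_measurable.
exact: measurable0.
Qed.

(** Of two words whose half-open cubes share a point, the shorter is a prefix of the longer, and a
    stopped word has no bad proper prefix. *)
Lemma stop_cell_triv : trivIset setT stop_cell.
Proof.
have H s s' x : (size s <= size s')%N -> stop_cell s x -> stop_cell s' x -> s = s'.
  move=> ss' [[bs _] sx] [[_ ns'] s'x].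
  have ts : take (size s) s' = s.
    apply: node_hcube_inj l0 _ _ sx; first by rewrite size_takel.
    by apply: (@node_hcube_prefix _ _ a l _ (drop (size s) s')); rewrite ?cat_take_drop.
  move: ss'; rewrite leq_eqVlt => /orP[/eqP ss'|/ns']; last by rewrite ts.
  by move: ts; rewrite ss' take_size.
move=> s s' _ _ [x [sx s'x]].
by have [/H/(_ sx s'x)|/ltnW/H/(_ s'x sx)] := leqP (size s) (size s').
Qed.

Lemma reachedE : reached = \bigcup_s stop_cell s.
Proof.
apply/seteqP; split => x => [[s sx bs]|[s _ [[bs _] sx]]]; last by exists s.
have ex : exists j, `[< bad (node_cube a l (take j s)) >].
  by exists (size s); apply/asboolP; rewrite take_size.
pose j := ex_minn ex; have [/asboolP bj mj] : `[< bad (node_cube a l (take j s)) >] /\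
    forall i, `[< bad (node_cube a l (take i s)) >] -> (j <= i)%N.
  by rewrite /j; case: ex_minnP.
exists (take j s) => //; split.
  split => // i; rewrite size_take_min leq_min => /andP[ij _] /asboolP.
  by rewrite (take_takel _ (ltnW ij)) => /mj; rewrite leqNgt ij.
by apply: (@node_hcube_prefix _ _ a l _ (drop j s)); rewrite ?cat_take_drop.
Qed.

Lemma stopped_parent s : ~ bad (cube a l) -> stopped s -> exists b r e,
  [/\ 0 < r <= l, cube b r `<=` cube a l, ~ bad (cube b r),
      bad (cube (child_corner b r e) (r / 2)) &
      node a l s = (child_corner b r e, r / 2)].
Proof.
move=> nb; case/lastP: s => [|s e] [bs ns]; first by [].
exists (node a l s).1, (node a l s).2, e.
have Es : node a l (rcons s e) = (child_corner (node a l s).1 (node a l s).2 e, (node a l s).2 / 2).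
  by rewrite -cats1 node_cat.
split => //.
- rewrite node_side_gt0//= node_side ler_pdivrMr ?exprn_gt0//.
  by rewrite ler_peMr ?(ltW l0)// exprn_ege1// ler1n.
- exact: node_cube_sub.
- have := ns (size s); rewrite size_rcons -cats1 take_size_cat//; exact.
- by move: bs; rewrite /node_cube Es.
Qed.

End stopping.

End density.

(** * Decay of the oscillation *)

Section concentration.
Context {R : realType} {n : nat}.
Local Notation T := 'rV[R]_n.+1.
Local Notation LebM := (@Leb R n).-cara.-measurable.
Implicit Types (a b : T) (l r s : R) (X Y : set T) (f : T -> R).

Lemma vol_cube a l : 0 < l -> vol (cube a l) = l ^+ n.+1.
Proof. by move=> l0; rewrite /vol Leb_cube. Qed.

Lemma vol_ge0 X : 0 <= vol X.
Proof. by rewrite fine_ge0// Leb_ge0. Qed.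

Lemma le_vol X Y a l : 0 < l -> X `<=` Y -> Y `<=` cube a l -> vol X <= vol Y.
Proof.
move=> l0 XY Ya; rewrite fine_le ?(le_Leb XY)//; apply: (Leb_fin l0) => //.
  by apply: subset_trans Ya.
exact: Ya.
Qed.

Lemma volU X Y a l : 0 < l -> LebM X -> X `<=` cube a l -> Y `<=` cube a l ->
  X `&` Y = set0 -> vol (X `|` Y) = vol X + vol Y.
Proof.
move=> l0 mX Xa Ya XY; rewrite /vol -fineD; [|exact: Leb_fin Xa|exact: Leb_fin Ya].
congr fine.
have -> : Leb (X `|` Y) = (Leb ((X `|` Y) `&` X) + Leb ((X `|` Y) `&` ~` X))%E by exact: mX.
rewrite setUK -setDE setDUl setDv set0U; congr (_ + Leb _)%E.
by apply/setDidPl; rewrite setIC.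
Qed.

Definition near_set f (c M : R) : set T := [set y | `|f y - c| < M].

Definition concentrated s f X (c M : R) : Prop :=
  (1 - s) * vol X < vol (X `&` near_set f c M).

Definition measurable_on f X : Prop :=
  forall B : set R, measurable B -> LebM (X `&` f @^-1` B).

Lemma near_set_measurable f X c M : measurable_on f X -> LebM (X `&` near_set f c M).
Proof.
move=> mf; rewrite (_ : near_set f c M = f @^-1` `](c - M), (c + M)[%classic).
  by apply: mf; exact: measurable_itv.
by apply/seteqP; split => y /=; rewrite in_itv /near_set/= ltr_distl.
Qed.

Lemma measurable_on_sub f X Y : Y `<=` X -> LebM Y ->
  measurable_on f X -> measurable_on f Y.
Proof.
move=> YX mY mf B mB; rewrite -(setIidl YX) -setIA.
by apply: measurableI => //; exact: mf.
Qed.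

Lemma concentrated_compl s f X Y (c M : R) a l : 0 < l -> X `<=` cube a l ->
  measurable_on f X -> concentrated s f X c M ->
  Y `<=` X -> Y `&` near_set f c M = set0 -> vol Y < s * vol X.
Proof.
move=> l0 Xa mf; rewrite /concentrated => conc YX Yc.
have : vol (X `&` near_set f c M) + vol Y <= vol X.
  rewrite -(@volU _ _ a l)//.
  - by apply: le_vol l0 _ Xa; rewrite subUset; split => // ? [].
  - exact: near_set_measurable.
  - by apply: subset_trans Xa => ? [].
  - exact: subset_trans Xa.
  - by rewrite -setIA (setIC _ Y) Yc setI0.
move: conc; lra.
Qed.

Section adjacent.
Variables (s : R) (f : T -> R) (c : set T -> R) (M : R) (b : T) (r : R).
Hypotheses (s_le : s <= 1 / 2 ^+ n.+1) (r0 : 0 < r) (M0 : 0 < M).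
Hypothesis mf : measurable_on f (cube b r).
Hypothesis conc : forall b' r', 0 < r' -> cube b' r' `<=` cube b r ->
  concentrated s f (cube b' r') (c (cube b' r')) M.

Let s_half : s <= 1 / 2 := le_half_of_le_pow s_le.

Let mf' b' r' : cube b' r' `<=` cube b r -> measurable_on f (cube b' r').
Proof. by move=> /measurable_on_sub; apply => //; exact: cube_measurable. Qed.

(* Move from a cube P to its child P' through the nested cubes Q x. If the centers
   of P and P' were far apart, some Q x would have f below c P + 3 M on exactly
   half of its volume, so that its center would be far from both, and the three
   disjoint sets where f is near these centers would not fit in P. *)
Lemma center_child_lt (e : {ffun 'I_n.+1 -> bool}) :
  c (cube (child_corner b r e) (r / 2)) < c (cube b r) + 6 * M.
Proof.
rewrite ltNge; apply/negP => far.
pose P := cube b r; pose P' := cube (child_corner b r e) (r / 2).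
rewrite -/P -/P' in far.
(* The nested cubes [Q x] shrink from [P] at [x = 0] to [P'] at [x = 1]. *)
pose side (x : R) := r * (1 - x / 2).
pose corner (x : R) : T := \row_i (b ord0 i + (if e i then x * (r / 2) else 0)).
pose Q x := cube (corner x) (side x).
have side_gt0 x : 0 <= x <= 1 -> 0 < side x.
  by move=> /andP[x0 x1]; rewrite mulr_gt0// subr_gt0; lra.
have Qle x y : 0 <= x -> x <= y -> y <= 1 -> Q y `<=` Q x.
  move=> x0 xy y1 z zy i; have := zy i; rewrite !mxE /side.
  have /andP : 0 <= (y - x) * (r / 2) /\ 0 <= (1 - y) * (r / 2).
    by split; apply: mulr_ge0; rewrite ?subr_ge0// divr_ge0// ltW.
  by case: ifP => _; lra.
have Q0 : Q 0 = P.
  rewrite /Q /side mul0r subr0 mulr1; congr cube.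
  by apply/rowP => i; rewrite !mxE mul0r if_same addr0.
have Q1 : Q 1 = P'.
  rewrite /Q /P' /side; congr cube; last by lra.
  by apply/rowP => i; rewrite !mxE mul1r.
have QP x : 0 <= x <= 1 -> Q x `<=` P by move=> /andP[? ?]; rewrite -Q0; exact: Qle.
have volQ x : 0 <= x <= 1 -> vol (Q x) = side x ^+ n.+1.
  by move=> x01; rewrite vol_cube// side_gt0.
(* Midway between [c P] and [c P + 6 * M]: a center within [M] of [t] is more than [2 * M] away from
   both [c P] and [c P'], so that near sets of radius [M] are disjoint. *)
pose t := c P + 3 * M.
pose A := [set y | f y < t].
pose cl : R -> R := clamp 0 1.
have cl01 x : 0 <= cl x <= 1 by exact/clamp_in/ler01.
pose w x := side (cl x) ^+ n.+1.
pose g x := vol (Q (cl x) `&` A).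
have cw : continuous w.
  move=> x; apply: (@continuous_comp _ _ _ (fun x => side (cl x)) (fun y => y ^+ n.+1)).
    apply: cvgM; first exact: cvg_cst.
    apply: cvgB; first exact: cvg_cst.
    by apply: cvgM; [exact: clamp_continuous|exact: cvg_cst].
  exact: exprn_continuous.
have gw x y : `|g x - g y| <= `|w x - w y|.
  wlog xy : x y / cl x <= cl y.
    move=> H; have [|/ltW] := leP (cl x) (cl y); first exact: H.
    by rewrite distrC (distrC (w x)); exact: H.
  have /andP[x0 x1] := cl01 x; have /andP[y0 y1] := cl01 y.
  have QQ := Qle _ _ x0 xy y1.
  have QPx := QP _ (cl01 x); have QPy := QP _ (cl01 y).
  have g1 : g y <= g x.
    by apply: (@le_vol _ _ b r) => // [z [/QQ //]|z [/QPx]].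
  have g2 : g x <= g y + (w x - w y).
    have -> : w x - w y = vol (Q (cl x) `\` Q (cl y)).
      rewrite /w -!volQ//; apply/eqP; rewrite subr_eq; apply/eqP.
      rewrite addrC -(@volU _ _ b r)//; last first.
      - by rewrite setDIK.
      - by move=> z [/QPx].
      - exact: cube_measurable.
      by rewrite setDUK.
    apply: (@le_trans _ _ (vol ((Q (cl y) `&` A) `|` (Q (cl x) `\` Q (cl y))))).
      apply: (@le_vol _ _ b r) => // [z [zx zA]|].
        by have [zy|zy] := pselect (Q (cl y) z); [left|right].
      by rewrite subUset; split => z [] => [/QPy|/QPx].
    rewrite (@volU _ _ b r)//.
    + have -> : A = f @^-1` `]-oo, t[%classic.
        by apply/seteqP; split => z /=; rewrite in_itv.
      by apply: mf' => //; exact: measurable_itv.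
    + by move=> z [/QPy].
    + by move=> z [/QPx].
    + by apply/seteqP; split => // z [[? ?] [? ?]].
  rewrite ger0_norm ?subr_ge0// (le_trans _ (ler_norm _))//; lra.
have cg : continuous g := dominated_continuous gw cw.
(* A center at most [t - M] puts the near set of [Q x] inside [A], one at least [t + M] puts it
   outside; as [1 - s >= 1 / 2], this decides on which side of one half the share of [A] lies. *)
have lowA x : 0 <= x <= 1 -> c (Q x) <= t - M -> vol (Q x) / 2 < vol (Q x `&` A).
  move=> x01 cx; have := conc (side_gt0 _ x01) (QP _ x01); rewrite /concentrated => cx'.
  apply: (@le_lt_trans _ _ ((1 - s) * vol (Q x))).
    rewrite mulrC ler_wpM2r ?vol_ge0//; move: s_half; lra.
  have QxP := QP _ x01.
  apply: lt_le_trans cx' _; apply: (@le_vol _ _ b r) => // z [Qz]; last by move=> _; exact: QxP.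
  rewrite /near_set /= ltr_distl => /andP[_ zc]; split => //; rewrite /A /=.
  move: zc cx; rewrite -/(Q x); lra.
have highA x : 0 <= x <= 1 -> t + M <= c (Q x) -> vol (Q x `&` A) < vol (Q x) / 2.
  move=> x01 cx; have := conc (side_gt0 _ x01) (QP _ x01) => cx'.
  apply: lt_le_trans (concentrated_compl (side_gt0 _ x01) (@subset_refl _ _)
      (mf' (QP _ x01)) cx' _ _) _.
  - by move=> z [].
  - apply/seteqP; split => // z [[_]]; rewrite /near_set /A /= ltr_distl.
    by move=> zt /andP[]; move: zt; move: cx; rewrite -/(Q x); lra.
  - rewrite [leRHS]mulrC ler_wpM2r ?vol_ge0//; move: s_half; lra.
pose h x := g x - w x / 2.
have [x x01 hx] : exists2 x, 0 <= x <= 1 & vol (Q x `&` A) = vol (Q x) / 2.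
  have [| | |x] := @IVT R h 0 1 0; first exact: ler01.
  - apply: continuous_subspaceT => x; apply: cvgB; first exact: cg.
    by apply: cvgM; [exact: cw|exact: cvg_cst].
  - apply/andP; split.
      rewrite ge_min; apply/orP; right; rewrite /h /g /w /cl clamp_id ?lexx ?ler01//.
      rewrite -volQ ?lexx ?ler01// subr_le0 ltW// highA ?lexx ?ler01// Q1.
      rewrite (le_trans _ far)// /t; move: M0; lra.
    rewrite le_max; apply/orP; left; rewrite /h /g /w /cl clamp_id ?lexx ?ler01//.
    rewrite -volQ ?lexx ?ler01// subr_ge0 ltW// lowA ?lexx ?ler01// Q0 /t.
    by move: M0; lra.
  rewrite in_itv/= => x01 /eqP; rewrite subr_eq0 /g /w /cl clamp_id// => /eqP hx.
  by exists x => //; rewrite hx volQ.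
have cx1 : t - M < c (Q x).
  by rewrite ltNge; apply/negP => /(lowA _ x01); rewrite hx ltxx.
have cx2 : c (Q x) < t + M.
  by rewrite ltNge; apply/negP => /(highA _ x01); rewrite hx ltxx.
pose F0 := P `&` near_set f (c P) M.
pose F1 := Q x `&` near_set f (c (Q x)) M.
pose F2 := P' `&` near_set f (c P') M.
have P'P : P' `<=` P by rewrite -Q1; apply: QP; rewrite ler01 lexx.
have sum : vol F0 + (vol F1 + vol F2) <= vol P.
  have QxP := QP _ x01.
  have F0P : F0 `<=` P by move=> z [].
  have F1P : F1 `<=` P by move=> z [/QxP].
  have F2P : F2 `<=` P by move=> z [/P'P].
  rewrite -(@volU F1 F2 b r)//; last 2 first.
  - exact/near_set_measurable/mf'.
  - apply/seteqP; split => // z [[_ h1] [_ h2]]; move: h1 h2.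
    by rewrite /near_set/= !ltr_distl => /andP[? ?] /andP[? ?]; move: far cx2; rewrite /t; lra.
  rewrite -(@volU F0 _ b r)//; last 3 first.
  - exact/near_set_measurable/mf'.
  - by rewrite subUset.
  - apply/seteqP; split => // z [[_ h0]]; rewrite /near_set/= ltr_distl in h0.
    case=> [] [_]; rewrite /near_set/= ltr_distl => /andP[? ?];
      move: h0 far cx1 M0 => /andP[? ?]; rewrite /t; lra.
  apply: (@le_vol _ _ b r) => //; rewrite !subUset; split => //; split => //.
have cF0 : (1 - s) * vol P < vol F0 by apply: conc.
have cF1 : (1 - s) * vol (Q x) < vol F1 by apply: conc; [exact: side_gt0|exact: QP].
have r20 : 0 < r / 2 by rewrite divr_gt0.
have cF2 : (1 - s) * vol P' < vol F2 by apply: conc.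
have V0 : 0 < vol P by rewrite vol_cube// exprn_gt0.
have vP' : vol P' = 1 / 2 ^+ n.+1 * vol P.
  by rewrite !vol_cube// expr_div_n mul1r mulrC.
have vQ : vol P' <= vol (Q x).
  apply: (@le_vol _ _ b r) => //; last exact: QP.
  by have /andP[? ?] := x01; rewrite -Q1; apply: Qle.
have sg : 1 / 2 ^+ n.+1 <= 1 / 2 :> R.
  rewrite ler_pM2l// lef_pV2 ?posrE ?exprn_gt0//.
  by rewrite exprS ler_peMr// exprn_ege1// ler1n.
have sg0 : 0 < 1 / 2 ^+ n.+1 :> R by rewrite divr_gt0// exprn_gt0.
move: s_le sg sg0 vP' vQ cF0 cF1 cF2 sum V0.
move: (vol P) (vol P') (vol (Q x)) (vol F0) (vol F1) (vol F2) (1 / 2 ^+ n.+1).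
move=> V V' W v0 v1 v2 sg ssg sg2 sg0 -> VW h0 h1 h2 hs V0.
(* With [sg = 2^-d] the three near sets have total volume above [(1 - sg) (1 + 2 sg) V = (1 + sg - 2
   sg^2) V], and this is at least [V] because [sg <= 1 / 2]. *)
have h1' : (1 - sg) * (sg * V) <= (1 - s) * W.
  apply: ler_pM; [lra| |lra|exact: VW].
  by rewrite mulr_ge0 ?ltW.
have h0' : (1 - sg) * V <= (1 - s) * V by apply: ler_wpM2r; [exact: ltW|lra].
have h2' : (1 - sg) * (sg * V) <= (1 - s) * (sg * V).
  by apply: ler_wpM2r; [rewrite mulr_ge0 ?ltW|lra].
have : 0 <= (1 / 2 - sg) * (sg * V) by rewrite mulr_ge0 ?mulr_ge0 ?(ltW sg0) ?(ltW V0) ?subr_ge0.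
lra.
Qed.

End adjacent.

(** The lower estimate is the upper one for [- f] with the centers [- c]. *)
Lemma center_child s f (c : set T -> R) M b r (e : {ffun 'I_n.+1 -> bool}) :
  s <= 1 / 2 ^+ n.+1 -> 0 < r -> 0 < M -> measurable_on f (cube b r) ->
  (forall b' r', 0 < r' -> cube b' r' `<=` cube b r ->
    concentrated s f (cube b' r') (c (cube b' r')) M) ->
  `|c (cube (child_corner b r e) (r / 2)) - c (cube b r)| < 6 * M.
Proof.
move=> s_le r0 M0 mf conc; rewrite ltr_distl; apply/andP; split; last first.
  exact: (@center_child_lt s f).
have := @center_child_lt s (\- f) (\- c) M b r s_le r0 M0 _ _ e.
suff [h1 h2] : measurable_on (\- f) (cube b r) /\
    (forall b' r', 0 < r' -> cube b' r' `<=` cube b r ->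
    concentrated s (\- f) (cube b' r') (- c (cube b' r')) M).
  by move=> /(_ h1 h2) /=; lra.
split.
  move=> B mB; have := mf (-%R @^-1` B).
  rewrite -comp_preimage; apply.
  by rewrite -[X in measurable X]setTI; exact: oppr_measurable.
move=> b' r' r'0 r'r; have := conc b' r' r'0 r'r; rewrite /concentrated.
congr (_ < vol (_ `&` _)); apply/seteqP; split => y; rewrite /near_set /=;
  by rewrite -opprD normrN.
Qed.

End concentration.

Section oscillation.
Context {R : realType} {n : nat}.
Local Notation T := 'rV[R]_n.+1.
Local Notation E := {ffun 'I_n.+1 -> bool}.
Local Notation LebM := (@Leb R n).-cara.-measurable.
Local Notation L := (2 ^ n.+2)%N.
Implicit Types (a b : T) (l r s : R) (X Y : set T) (f : T -> R).

Lemma LebU2 X Y : (Leb (X `|` Y) <= Leb X + Leb Y)%E.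
Proof. exact: outer_measureU2. Qed.

Lemma Leb_hcubeI X a l : 0 < l -> Leb (hcube a l `&` X) = Leb (cube a l `&` X).
Proof.
move=> l0; apply/eqP; rewrite eq_le; apply/andP; split.
  by apply: le_Leb => x [/hcube_sub_cube].
apply: (@le_trans _ _ (Leb ((hcube a l `&` X) `|` (cube a l `\` hcube a l)))).
  apply: le_Leb => x [ax Xx]; have [hx|hx] := pselect (hcube a l x); first by left.
  by right.
by apply: le_trans (LebU2 _ _) _; rewrite Leb_cubeD_hcube// adde0.
Qed.

(** * One round of stopping at a fixed radius *)

Section step.
Variables (s : R) (f : T -> R) (c : set T -> R) (M : R) (a : T) (l : R).
Hypotheses (s_gt0 : 0 < s) (s_le : s <= 1 / 2 ^+ n.+1) (l0 : 0 < l) (M0 : 0 < M).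
Hypothesis mf : measurable_on f (cube a l).
Hypothesis conc : forall b r, 0 < r -> cube b r `<=` cube a l ->
  concentrated s f (cube b r) (c (cube b r)) M.

Definition far (i : nat) (P : set T) : Prop :=
  8 * i%:R * M < `|c P - c (cube a l)|.

Local Notation level i := (reached (far i) a l).

Lemma far_root i : ~ far i (cube a l).
Proof. by rewrite /far subrr normr0; apply/negP; rewrite -leNgt !mulr_ge0// ltW. Qed.

Lemma level_nincr i j : (i <= j)%N -> level j `<=` level i.
Proof.
move=> ij x [p px fp]; exists p => //; apply: le_lt_trans fp.
by rewrite ler_wpM2r ?(ltW M0)// ler_wpM2l// ler_nat.
Qed.

(** The parent is not far, and one generation moves the center by less than [6 M]. The root is never
    far, so the side has been halved at least once. *)
Lemma stopped_center i p : stopped (far i) a l p ->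
  [/\ 0 < (node a l p).2, (node a l p).2 <= l / 2, node_cube a l p `<=` cube a l &
   8 * i%:R * M < `|c (node_cube a l p) - c (cube a l)| < (8 * i%:R + 6) * M].
Proof.
move=> sp; have [b [r [e [/andP[r0 rl] ba nfb _ np]]]] := stopped_parent l0 (@far_root i) sp.
have fp : far i (node_cube a l p) by case: sp.
split.
- by rewrite np divr_gt0.
- by rewrite np ler_pM2r.
- exact: node_cube_sub.
rewrite fp/=; move: nfb; rewrite /far => /negP; rewrite -leNgt => nfb.
have : `|c (node_cube a l p) - c (cube b r)| < 6 * M.
  rewrite /node_cube np /=; apply: (@center_child R n s f) => //.
    by apply: measurable_on_sub mf => //; exact: cube_measurable.
  by move=> b' r' r'0 r'r; apply: conc => //; exact: subset_trans ba.
move: nfb; have := ler_distD (c (cube b r)) (c (node_cube a l p)) (c (cube a l)).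
lra.
Qed.

(** The range [8 i M] to [(8 i + 6) M] of the stopped centers, widened by the radius [M] on both
    sides. The spacing 8 of the thresholds makes consecutive shells abut:
    [8 i + 7 = 8 (i + 1) - 1]. *)
Definition shell (i : nat) : set T :=
  hcube a l `&` [set y | (8 * i%:R - 1) * M < `|f y - c (cube a l)| < (8 * i%:R + 7) * M].

Lemma shell_measurable i : LebM (shell i).
Proof.
have mh : measurable_on f (hcube a l).
  by apply: measurable_on_sub mf; [exact: hcube_sub_cube|exact: hcube_measurable].
set I := `](8 * i%:R - 1) * M, (8 * i%:R + 7) * M[%classic.
rewrite /shell (_ : [set y | _] = f @^-1` ((fun u => `|u - c (cube a l)|) @^-1` I)); last first.
  by apply/seteqP; split => y; rewrite /I /= in_itv.
apply: mh.
rewrite -[X in measurable X]setTI.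
have : measurable_fun setT (fun u : R => `|u - c (cube a l)|).
  apply: measurableT_comp; first exact: normr_measurable.
  by apply: measurable_funB => //; exact: measurable_cst.
by apply => //; exact: measurable_itv.
Qed.

Lemma shell_triv : trivIset setT shell.
Proof.
move=> i j _ _ [y [[_ /= hi] [_ /= hj]]].
have H k m : (8 * k%:R - 1) * M < (8 * m%:R + 7) * M -> (k <= m)%N.
  rewrite ltr_pM2r// => km; rewrite -ltnS -(ltr_nat R) -natr1; lra.
move: hi hj => /andP[i1 i2] /andP[j1 j2]; apply/eqP.
by rewrite eqn_leq (H i j (lt_trans i1 j2)) (H j i (lt_trans j1 i2)).
Qed.

Lemma shell_level_ge i : ((1 - s)%:E * Leb (level i) <= Leb (shell i))%E.
Proof.
have s1 : 0 <= 1 - s by have := le_half_of_le_pow s_le; lra.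
apply: (@le_trans _ _ (Leb (shell i `&` level i))); last first.
  by apply: le_Leb => ? [].
rewrite (reachedE _ _ l0); apply: Leb_family_ge => //.
- exact: stop_cell_measurable.
- exact: stop_cell_triv.
move=> p; have [sp|nsp] := pselect (stopped (far i) a l p); last first.
  by rewrite stop_cell0// setI0 Leb0 mule0.
have [r0 _ pa /andP[c1 c2]] := stopped_center sp.
rewrite stop_cellE// {1}/node_hcube Leb_hcube//.
have := conc r0 pa; rewrite /concentrated vol_cube// => /ltW cc.
apply: (@le_trans _ _ (Leb (node_hcube a l p `&` near_set f (c (node_cube a l p)) M))).
  rewrite /node_hcube Leb_hcubeI// -EFinM.
  rewrite -[leRHS]fineK ?lee_fin//; apply: (Leb_fin l0) => x [/pa ax _]; exact: ax.
apply: le_Leb => y [py]; rewrite /near_set/= => yc; split => //; split.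
  exact: node_hcube_sub py.
rewrite /=.
have := ler_distD (f y) (c (node_cube a l p)) (c (cube a l)).
have := ler_distD (c (node_cube a l p)) (f y) (c (cube a l)).
rewrite (distrC (c _) (f y)); move: c1 c2 yc.
by move=> *; apply/andP; split; lra.
Qed.

(* A point of level L lies in cubes stopped at every level i < L. On at least half
   of each of these, f lies in the i-th shell, and the shells are disjoint. *)
Lemma level_small : ((2 ^+ n.+1)%:E * Leb (level L) <= Leb (cube a l))%E.
Proof.
have Lf i : Leb (level i) \is a fin_num.
  by apply: (@Leb_fin R n _ a l l0) => x [p /(node_hcube_sub l0) /hcube_sub_cube].
apply: (@le_trans _ _ (\sum_(i < L) Leb (cube a l `&` shell i))%E); last first.
  rewrite -(caratheodory_additive shell_measurable shell_triv).
  by apply: le_Leb => ? [].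
(* [L] is chosen so that [L / 2 = 2^d]. *)
apply: (@le_trans _ _ (\sum_(i < L) (1 / 2)%:E * Leb (level L))%E).
  rewrite -(fineK (Lf L)) -!EFinM sumEFin lee_fin sumr_const card_ord -[leRHS]mulr_natl natrX.
  by rewrite [X in _ <= X * _]exprS; lra.
apply: lee_sum => i _.
apply: (@le_trans _ _ (Leb (shell i))); last first.
  by apply: le_Leb => x xs; split => //; apply: hcube_sub_cube; case: xs.
apply: le_trans (shell_level_ge i).
apply: (@le_trans _ _ ((1 - s)%:E * Leb (level L))%E).
  by apply: lee_wpmul2r; rewrite ?Leb_ge0// lee_fin; have := le_half_of_le_pow s_le; lra.
apply: lee_wpmul2l; first by rewrite lee_fin; have := le_half_of_le_pow s_le; lra.
by apply: le_Leb; apply: level_nincr; exact/ltnW.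
Qed.

(** A far dyadic subcube does not meet this set. In any other, the center is within [8 i M] of that
    of the root, so the set avoids the near set and has a share below [s < 1]. *)
Lemma off_level_null i :
  Leb ((hcube a l `\` level i) `&` [set y | (8 * i%:R + 1) * M < `|f y - c (cube a l)|]) = 0.
Proof.
have s12 := le_half_of_le_pow s_le.
apply: (@null_of_density _ _ _ a l s) => //.
- exact: ltW.
- lra.
- by move=> x [[]].
move=> p; set X := (X in X `&` _).
have p0 := node_side_gt0 a p l0.
have [fp|nfp] := pselect (far i (node_cube a l p)).
  rewrite [X in Leb X](_ : _ = set0) ?Leb0 ?mule_ge0 ?Leb_ge0 ?lee_fin ?ltW//.
  by apply/seteqP; split => // x [[[_ nx] _] px]; apply: nx; exists p.
have pa := @node_cube_sub R n a l p l0.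
have Xp : X `&` node_hcube a l p `<=` node_cube a l p by move=> x [_ /hcube_sub_cube].
have := @concentrated_compl R n s f (node_cube a l p) (X `&` node_hcube a l p)
  (c (node_cube a l p)) M a l l0 pa _ (conc p0 pa) Xp.
rewrite /node_hcube Leb_hcube// /node_cube vol_cube// => H.
rewrite -[leLHS]fineK; last by apply: (@Leb_fin R n _ a l l0) => x /Xp/pa.
rewrite -EFinM lee_fin ltW// H//.
  by apply: measurable_on_sub mf => //; exact: cube_measurable.
apply/seteqP; split => // y [[[_ yf] _]]; rewrite /near_set/= => yc.
move: nfp yf; rewrite /far /= => /negP; rewrite -leNgt.
have := ler_distD (c (node_cube a l p)) (f y) (c (cube a l)).
by rewrite /node_cube; move: yc; lra.
Qed.

End step.

(** Exceeds both errors of a round in units of [M]: [8 L + 1] off the last stopped set, [8 L + 6]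
    from the center of a stopped cube to that of the root. *)
Definition decay_factor : R := 8 * L%:R + 8.

(** * Iteration of the rounds *)

Section decay.
Variables (s : R) (f : T -> R) (c : set T -> R) (m : R -> R) (U : set T).
Hypotheses (s_gt0 : 0 < s) (s_le : s <= 1 / 2 ^+ n.+1).
Hypothesis m_gt0 : forall r, 0 < r -> 0 < m r.
Hypothesis m_ndecr : forall r r', 0 < r -> r <= r' -> m r <= m r'.
Hypothesis mf : forall b r, 0 < r -> cube b r `<=` U -> measurable_on f (cube b r).
Hypothesis conc : forall b r, 0 < r -> cube b r `<=` U ->
  concentrated s f (cube b r) (c (cube b r)) (m r).

Lemma cube_sub_side a b l r : 0 < r -> cube b r `<=` cube a l -> r <= l.
Proof.
move=> r0 ba; have b1 : cube b r b by move=> i; rewrite lexx/= lerDl ltW.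
have b2 : cube b r (b + const_mx r) by move=> i; rewrite !mxE lexx lerDl ltW.
have /andP[h1 _] := ba _ b1 ord0; have /andP[_] := ba _ b2 ord0; rewrite !mxE; lra.
Qed.

(** A round with [M = m l] costs the term [j = 0] and leaves stopped cubes of total volume at most
    [2^-d] times that of the cube; in each of them the induction hypothesis keeps a share of at most
    [2^-dk]. *)
Lemma oscillation_decay k a l : 0 < l -> cube a l `<=` U ->
  (Leb (cube a l `&` [set y | (decay_factor * (\sum_(j < k) m (l / 2 ^+ j)) <
                             `|f y - c (cube a l)|)%R])
   <= ((l / 2 ^+ k) ^+ n.+1)%:E)%E.
Proof.
elim: k a l => [|k IH] a l l0 aU.
  by rewrite divr1 -(Leb_cube a l0); apply: le_Leb => x [].
set Z := [set y | _].
have M0 := m_gt0 l0; have mfa := mf l0 aU.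
have conca b r : 0 < r -> cube b r `<=` cube a l ->
    concentrated s f (cube b r) (c (cube b r)) (m l).
  move=> r0 ba; have bU : cube b r `<=` U by exact: subset_trans aU.
  apply: lt_le_trans (conc r0 bU) _; apply: (@le_vol R n _ _ b r); [by []| |by move=> x []].
  move=> x [bx]; rewrite /near_set/= => xc; split => //=.
  by apply: lt_le_trans xc _; apply: m_ndecr => //; exact: cube_sub_side ba.
pose D := reached (far c (m l) a l L) a l.
apply: (@le_trans _ _ (Leb (((hcube a l `\` D) `&`
    [set y | (8 * L%:R + 1) * m l < `|f y - c (cube a l)|]) `|` (Z `&` D)))).
  rewrite -Leb_hcubeI//; apply: le_Leb => y [ay Zy].
  have [Dy|nDy] := pselect (D y); [by right|left; split => //].
  apply: le_lt_trans Zy; rewrite /decay_factor big_ord_recl divr1 mulrDr.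
  rewrite -[leLHS]addr0 lerD//.
    by rewrite ler_wpM2r ?(ltW M0)//; lra.
  apply: mulr_ge0; first by rewrite addr_ge0// mulr_ge0.
  by apply: sumr_ge0 => j _; apply/ltW/m_gt0; rewrite divr_gt0// exprn_gt0.
apply: le_trans (LebU2 _ _) _.
rewrite (off_level_null s_gt0 s_le l0 mfa conca) add0e.
apply: (@le_trans _ _ (((2 ^+ k)^-1 ^+ n.+1)%:E * Leb D)%E); last first.
  have := level_small s_le l0 M0 mfa conca; rewrite Leb_cube// -/D.
  have : Leb D \is a fin_num.
    by apply: (@Leb_fin R n _ a l l0) => x [p /(node_hcube_sub l0) /hcube_sub_cube].
  move=> /fineK <-; rewrite -!EFinM !lee_fin => h.
  apply: (@le_trans _ _ ((2 ^+ k.+1)^-1 ^+ n.+1 * (2 ^+ n.+1 * fine (Leb D)))).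
    by rewrite mulrA -exprMn (exprSr _ k) invfM mulfVK.
  by rewrite exprMn mulrC ler_wpM2r// exprn_ge0// invr_ge0 exprn_ge0.
rewrite /D (reachedE _ _ l0); apply: Leb_family_le => //.
- exact: stop_cell_measurable.
- exact: stop_cell_triv.
move=> p; have [sp|nsp] := pselect (stopped (far c (m l) a l L) a l p); last first.
  by rewrite stop_cell0// setI0 Leb0 mule0.
have [r0 rl pa /andP[_ c2]] := stopped_center s_le l0 M0 mfa conca sp.
rewrite stop_cellE//; set r := (node a l p).2 in r0 rl.
have -> : Leb (node_hcube a l p) = (r ^+ n.+1)%:E by rewrite /node_hcube Leb_hcube.
rewrite -EFinM mulrC -exprMn; apply: le_trans (IH _ _ r0 (subset_trans pa aU)).
apply: le_Leb => y [Zy py]; split; first exact: hcube_sub_cube py.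
rewrite /=; have : decay_factor * (\sum_(j < k.+1) m (l / 2 ^+ j)) < `|f y - c (cube a l)| by [].
rewrite big_ord_recl divr1 mulrDr.
(* As [r <= l / 2], the term of index [j] for [r] is at most the term of index [j + 1] for [l]. *)
have : decay_factor * (\sum_(j < k) m (r / 2 ^+ j)) <=
    decay_factor * (\sum_(j < k) m (l / 2 ^+ lift ord0 j)).
  apply: ler_wpM2l; first by rewrite addr_ge0// mulr_ge0.
  apply: ler_sum => j _; apply: m_ndecr; first by rewrite divr_gt0// exprn_gt0.
  by rewrite /= exprS invfM mulrA ler_wpM2r// invr_ge0 exprn_ge0.
have := ler_distD (c (node_cube a l p)) (f y) (c (cube a l)).
rewrite -/(node_cube a l p); move: c2 M0; rewrite /decay_factor; lra.
Qed.

End decay.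
End oscillation.

(** * The function Psi and its inverse *)

Section Psi_theory.
Context {R : realType}.
Variables (phi : R -> R) (d : nat) (V : R).
Hypothesis phi_cont : {within `[0, +oo[, continuous phi}.
Hypothesis phi_ndecr : {in `[0, +oo[ &, {homo phi : u v / u <= v}}.
Hypothesis phi_gt0 : forall u, 0 < u -> 0 < phi u.
Hypothesis V0 : 0 < V.

Local Notation B := (2 ^+ d * V).
Local Notation sg k := (B / (2 ^+ d) ^+ k).
Local Notation psi := (Psi d phi V).
Local Notation mu := lebesgue_measure.

Let B0 : 0 < B. Proof. by rewrite mulr_gt0// exprn_gt0. Qed.

Let phi_le u v : 0 <= u -> u <= v -> phi u <= phi v.
Proof.
by move=> u0 uv; apply: phi_ndecr => //; rewrite in_itv/= andbT// (le_trans u0).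
Qed.

Let integrand_measurable u (b : itv_bound R) : 0 < u ->
  measurable_fun ([set` Interval (BLeft u) b] : set R) (fun v => (phi v / v)%:E).
Proof.
move=> u0; apply/measurable_EFinP.
have ub : [set` Interval (BLeft u) b] `<=` (`]0, +oo[%classic : set R).
  by move=> v /=; rewrite !in_itv/= => /andP[uv _]; rewrite andbT (lt_le_trans u0).
apply: measurable_funM.
  have mphi : measurable_fun (`[0, +oo[%classic : set R) phi.
    by apply: subspace_continuous_measurable_fun => //; exact: measurable_itv.
  apply: measurable_funS mphi; first exact: measurable_itv.
  by apply: subset_trans ub _ => v /=; rewrite !in_itv/= !andbT => /ltW.
have minv : measurable_fun (`]0, +oo[%classic : set R) (fun v : R => v^-1).
  apply: open_continuous_measurable_fun; first exact: interval_open.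
  move=> v; rewrite inE/= in_itv/= andbT => v0; apply: cvgV; last exact: cvg_id.
  by rewrite gt_eqF.
by apply: measurable_funS minv => //; exact: measurable_itv.
Qed.

Let integrand_ge0 u : 0 < u -> (0 <= (phi u / u)%:E)%E.
Proof. by move=> u0; rewrite lee_fin ltW// divr_gt0// phi_gt0. Qed.

Lemma Psi_split u v : 0 < u -> u <= v -> v <= B ->
  (psi u = \int[mu]_(x in `[u, v[) (phi x / x)%:E + psi v)%E.
Proof.
move=> u0 uv vB; rewrite /Psi (@itv_bndbnd_setU _ _ (BLeft u) (BLeft v) (BRight B))//.
rewrite ge0_integral_setU//.
- rewrite -(@itv_bndbnd_setU _ _ (BLeft u) (BLeft v) (BRight B))//; exact: integrand_measurable.
- move=> x; rewrite -(@itv_bndbnd_setU _ _ (BLeft u) (BLeft v) (BRight B))// /= in_itv/= => /andP[ux _].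
  by apply: integrand_ge0; exact: lt_le_trans ux.
- apply/disj_setPS => x /= []; rewrite !in_itv/= => /andP[_ xv] /andP[vx _].
  by move: xv; rewrite ltNge vx.
Qed.

Lemma Psi_nincr u v : 0 < u -> u <= v -> v <= B -> (psi v <= psi u)%E.
Proof.
move=> u0 uv vB; rewrite (Psi_split u0 uv vB) leeDr//.
apply: integral_ge0 => x /=; rewrite in_itv/= => /andP[ux _].
by apply: integrand_ge0; exact: lt_le_trans ux.
Qed.

Lemma Psi_right_end : psi B = 0%E.
Proof. by rewrite /Psi set_itv1 integral_set1. Qed.

(** The integrand is at most [phi B / u] on [[u, B]]; this makes [psi] finite and Lipschitz
    there. *)
Lemma Psi_increment_le u v w : 0 < u -> u <= v -> v <= w -> w <= B ->
  (psi v <= (phi B / u * (w - v))%:E + psi w)%E.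
Proof.
move=> u0 uv vw wB; rewrite (Psi_split (lt_le_trans u0 uv) vw wB) leeD2r//.
have -> : (phi B / u * (w - v))%:E = (\int[mu]_(x in `[v, w[) (cst (phi B / u)%:E x))%E.
  rewrite integral_cst//= lebesgue_measure_itv/= lte_fin.
  case: ltP => // wv; have -> : w = v by apply/eqP; rewrite eq_le vw wv.
  by rewrite subrr mulr0 mule0.
apply: ge0_le_integral => //=.
- move=> x /=; rewrite in_itv/= => /andP[ux _].
  by apply: integrand_ge0; rewrite (lt_le_trans u0)// (le_trans uv).
- by apply: integrand_measurable; exact: lt_le_trans uv.
- move=> x /=; rewrite in_itv/= => /andP[vx xw]; rewrite lee_fin.
  have ux := le_trans uv vx; have x0 := lt_le_trans u0 ux.
  apply: ler_pM; rewrite ?invr_ge0 ?(ltW x0)//; first exact/ltW/phi_gt0.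
    by apply: phi_le; [exact: ltW|rewrite (le_trans (ltW xw))].
  by rewrite lef_pV2.
Qed.

(** The integrand is at least [phi u / (2^d u)] on an interval of length [(2^d - 1) u], whence the
    constant [1 - 2^-d]. *)
Lemma Psi_increment_ge u : 0 < u -> 2 ^+ d * u <= B ->
  (((1 - (2 ^+ d)^-1) * phi u)%:E + psi (2 ^+ d * u) <= psi u)%E.
Proof.
move=> u0 uB; have d1 : 1 <= 2 ^+ d :> R by rewrite exprn_ege1// ler1n.
have d0 : 0 < 2 ^+ d :> R by rewrite exprn_gt0.
have uu : u <= 2 ^+ d * u by rewrite ler_peMl// ltW.
rewrite (Psi_split u0 uu uB) leeD2r//.
apply: (@le_trans _ _ (\int[mu]_(x in `[u, (2 ^+ d * u)%R[) (cst (phi u / (2 ^+ d * u))%:E x))%E).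
  rewrite integral_cst//= lebesgue_measure_itv/= lte_fin.
  case: ltP => [_|/(conj uu)/andP]; last first.
    rewrite -eq_le => /eqP du; rewrite mule0 lee_fin.
    suff -> : 2 ^+ d = 1 :> R by rewrite invr1 subrr mul0r.
    by apply: (mulIf (lt0r_neq0 u0)); rewrite mul1r -du.
  rewrite -EFinD -EFinM lee_fin le_eqVlt; apply/orP; left; apply/eqP.
  by field; rewrite !gt_eqF.
apply: ge0_le_integral => //=.
- by move=> x _; rewrite lee_fin ltW// divr_gt0 ?phi_gt0// mulr_gt0.
- exact: integrand_measurable.
- move=> x /=; rewrite in_itv/= => /andP[ux xu]; rewrite lee_fin.
  have x0 := lt_le_trans u0 ux.
  apply: ler_pM; rewrite ?invr_ge0 ?mulr_ge0 ?(ltW d0) ?(ltW u0)//; first exact/ltW/phi_gt0.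
    by apply: phi_le; [exact: ltW|].
  by rewrite lef_pV2 ?posrE ?mulr_gt0// ltW.
Qed.

(** The intervals from [sg (j + 1) = V / 2^(dj)] to [sg j] tile [[sg k, B]]; the upper limit [2^d V]
    of the integral makes room for [j = 0]. *)
Lemma Psi_sum_le k :
  (((1 - (2 ^+ d)^-1) * \sum_(j < k) phi (V / (2 ^+ d) ^+ j))%:E <= psi (sg k))%E.
Proof.
have d0 : 0 < 2 ^+ d :> R by rewrite exprn_gt0.
elim: k => [|k IH]; first by rewrite big_ord0 mulr0 divr1 Psi_right_end.
have sgS : sg k.+1 = V / (2 ^+ d) ^+ k.
  by rewrite exprS -mulf_div divff ?gt_eqF// mul1r.
have dsg : 2 ^+ d * sg k.+1 = sg k by rewrite sgS mulrA.
rewrite big_ord_recr/= mulrDr EFinD addeC -sgS.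
apply: le_trans (Psi_increment_ge _ _); rewrite ?dsg.
- by rewrite leeD2l.
- by rewrite divr_gt0// exprn_gt0.
- by rewrite ler_pdivrMr ?exprn_gt0// ler_peMr ?(ltW B0)// exprn_ege1// exprn_ege1// ler1n.
Qed.

(* [xget] in [Psi_inv] would return the junk value 0 on an empty set. *)
Lemma Psi_surj u0 y : 0 < u0 -> u0 <= B -> 0 <= y -> (y%:E <= psi u0)%E ->
  exists2 u, 0 < u <= B & psi u = y%:E.
Proof.
move=> u00 u0B y0 yu0.
have fin u : u0 <= u <= B -> psi u \is a fin_num.
  move=> /andP[u0u uB]; rewrite ge0_fin_numE; last first.
    by rewrite -Psi_right_end; apply: Psi_nincr => //; exact: lt_le_trans u0u.
  apply: le_lt_trans (Psi_increment_le u00 u0u uB (lexx _)) _.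
  by rewrite Psi_right_end adde0 ltry.
pose cl : R -> R := clamp u0 B.
have cl_in x : u0 <= cl x <= B by exact: clamp_in.
pose g x := fine (psi (cl x)).
pose w x := phi B / u0 * cl x.
have cw : continuous w.
  by move=> x; apply: cvgM; [exact: cvg_cst|exact: clamp_continuous].
have gw x z : `|g x - g z| <= `|w x - w z|.
  wlog xz : x z / cl x <= cl z.
    move=> H; have [|/ltW] := leP (cl x) (cl z); first exact: H.
    by rewrite distrC (distrC (w x)); exact: H.
  have /andP[x0 x1] := cl_in x; have /andP[z0 z1] := cl_in z.
  have := Psi_increment_le u00 x0 xz z1.
  have := Psi_nincr (lt_le_trans u00 x0) xz z1.
  rewrite -(fineK (fin _ (cl_in x))) -(fineK (fin _ (cl_in z))) -EFinD !lee_fin.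
  rewrite -/(g x) -/(g z) => g1 g2.
  rewrite ger0_norm ?subr_ge0// distrC (le_trans _ (ler_norm _))// /w -mulrBr.
  by rewrite lerBlDr.
have cg : continuous g := dominated_continuous gw cw.
have u0in : u0 <= u0 <= B by rewrite lexx.
have Bin : u0 <= B <= B by rewrite lexx u0B.
have [| | |u] := @IVT R g u0 B y; first exact: u0B.
- exact: continuous_subspaceT.
- apply/andP; split.
    by rewrite ge_min /g /cl (@clamp_id _ _ _ B)// Psi_right_end /= y0 orbT.
  by rewrite le_max /g /cl (@clamp_id _ _ _ u0)// -lee_fin fineK ?fin// yu0.
rewrite in_itv/= => uin; rewrite /g /cl clamp_id// => gu; exists u.
  by case/andP: uin => h1 h2; rewrite (lt_le_trans u00)//.
by rewrite -gu fineK ?fin.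
Qed.

(** Let [psi u = y] and let [k] be least with [V / 2^(dk) < u]. Then [u <= sg k], so the sum is at
    most [psi u = y] and the resulting bound on [v] is below [u]: no constant is lost. *)
Lemma Psi_inv_bound (v : \bar R) y : (0 < d)%N -> 0 < y ->
  (forall k, (1 - (2 ^+ d)^-1) * (\sum_(j < k) phi (V / (2 ^+ d) ^+ j)) <= y ->
    (v <= (V / (2 ^+ d) ^+ k)%:E)%E) ->
  (v <= (Psi_inv d phi V y)%:E)%E.
Proof.
move=> d_gt0 y0 vk.
have d1 : 1 < 2 ^+ d :> R by rewrite exprn_egt1 ?ltr1n// -lt0n.
have d0 : 0 < 2 ^+ d :> R by exact: lt_trans d1.
have sg0 k : 0 < sg k by rewrite divr_gt0// exprn_gt0.
have sgB k : sg k <= B.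
  by rewrite ler_pdivrMr ?exprn_gt0// ler_peMr ?(ltW B0)// exprn_ege1// ltW.
have := @nonincreasing_at_right_cvge R psi 0 (BRight B).
rewrite bnd_simp => /(_ B0).
have nincr : {in `]0, B] &, {homo psi : x z / x <= z >-> (z <= x)%E}}.
  move=> x z; rewrite !in_itv/= => /andP[x0 xB] /andP[z0 zB] xz.
  exact: Psi_nincr.
move=> /(_ nincr) cv; have lim_eq := cvg_lim (@ereal_hausdorff R) cv.
rewrite /Psi_inv lim_eq; case: ifPn => [supy|].
  (* Where the inverse is 0 by convention, every [k] is admissible and the bounds tend to 0. *)
  have H k : (v <= (V / (2 ^+ d) ^+ k)%:E)%E.
    apply: vk; rewrite -lee_fin; apply: le_trans (Psi_sum_le k) _.
    apply: le_trans supy; apply: ereal_sup_ubound; exists (sg k) => //=.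
    by rewrite in_itv/= sg0 sgB.
  apply/lee_addgt0Pr => e e0; rewrite add0e.
  by have [k /ltW ke] := exists_div_pow_lt V d1 e0; apply: le_trans (H k) _; rewrite lee_fin.
rewrite -ltNge => /ereal_sup_gt[_ [u0 /= + <-] /ltW yu0].
rewrite in_itv/= => /andP[u00 u0B].
set S := [set u | _].
have /(xgetPex 0) : exists u, S u.
  by have [u uB uy] := Psi_surj u00 u0B (ltW y0) yu0; exists u.
move: (xget 0 S) => u [/andP[u_gt0 uB] uy].
have ex := exists_div_pow_lt V d1 u_gt0.
case: (ex_minnP ex) => k ku kmin.
apply: le_trans (vk k _) _; last by rewrite lee_fin ltW.
rewrite -lee_fin -uy; apply: le_trans (Psi_sum_le k) _.
(* For [k = 0] minimality says nothing, but [sg 0 = B]. *)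
apply: Psi_nincr => //; case: k ku kmin => [|k] ku kmin; first by rewrite divr1.
have -> : sg k.+1 = V / (2 ^+ d) ^+ k.
  by rewrite exprS -mulf_div divff ?gt_eqF// mul1r.
by rewrite leNgt; apply/negP => /kmin; rewrite ltnn.
Qed.

End Psi_theory.

(** * Medians *)

Section medians.
Context {R : realType} {n : nat}.
Local Notation T := 'rV[R]_n.+1.
Local Notation LebM := (@Leb R n).-cara.-measurable.
Implicit Types (a b : T) (l r s : R) (X Y : set T) (f g : T -> R).

(** The sets where [g < k] exhaust the cube, so one of them has a share above [t]. On an unbounded
    set [sup] would be a default value. *)
Lemma has_ubound_median_set g t a l : 0 < l -> measurable_on g (cube a l) -> t < 1 ->
  has_ubound [set M : R | (Leb (cube a l `&` [set y | (g y < M)%R])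
                           <= t%:E * Leb (cube a l))%E].
Proof.
move=> l0 mg t1.
pose F (k : nat) := cube a l `&` [set y | g y < k%:R].
have mF k : LebM (F k).
  rewrite /F (_ : [set y | _] = g @^-1` `]-oo, k%:R[%classic).
    by apply: mg; exact: measurable_itv.
  by apply/seteqP; split => y /=; rewrite in_itv.
have FQ : \bigcup_k F k = cube a l.
  apply/seteqP; split => [y [k _ []]//|y ay]; exists (Num.truncn `|g y|).+1 => //.
  by split => //=; apply: le_lt_trans (ler_norm _) _; exact: truncnS_gt.
have : (Leb \o F) k @[k --> \oo] --> Leb (\bigcup_k F k).
  apply: (@nondecreasing_cvg_mu _ _ _ (@Leb_measure R n)) => //.
    by rewrite FQ; exact: cube_measurable.
  move=> i j ij; apply/subsetPset => y [ay gi]; split => //.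
  by apply: lt_le_trans gi _; rewrite ler_nat.
rewrite FQ Leb_cube// => cv.
have tl : ((t * l ^+ n.+1)%:E < (l ^+ n.+1)%:E)%E by rewrite lte_fin gtr_pMl ?exprn_gt0.
have [k _ /(_ k (leqnn k)) /= kt] := cv _ (open_ereal_gt' tl).
exists k%:R => M /= Mt; rewrite leNgt; apply/negP => kM.
move: kt; rewrite EFinM ltNge => /negP; apply.
apply: (@le_trans _ _ (Leb (cube a l `&` [set y | g y < M]))); last exact: Mt.
by apply: le_Leb => y [ay gy]; split => //=; exact: lt_trans gy kM.
Qed.

(** Were the share of the near set at most [1 - s], [M] would belong to the set whose supremum is
    the median. *)
Lemma concentrated_of_median f s a l c M : 0 < l -> 0 < s ->
  measurable_on f (cube a l) ->
  max_median (fun y => `|f y - c|) (1 - s) (cube a l) < M ->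
  concentrated s f (cube a l) c M.
Proof.
move=> l0 s0 mf mM.
have mg : measurable_on (fun y => `|f y - c|) (cube a l).
  move=> B mB; have := mf ((fun u => `|u - c|) @^-1` B).
  rewrite -comp_preimage; apply; rewrite -[X in measurable X]setTI.
  have : measurable_fun setT (fun u : R => `|u - c|).
    apply: measurableT_comp; first exact: normr_measurable.
    by apply: measurable_funB => //; exact: measurable_cst.
  exact.
have t1 : 1 - s < 1 by rewrite ltrBlDr ltrDl.
rewrite /concentrated ltNge; apply/negP => le.
move: mM; rewrite ltNge => /negP; apply.
apply: ub_le_sup; first exact: has_ubound_median_set.
move: le; rewrite /= /vol -lee_fin EFinM.
rewrite !fineK//; apply: (@Leb_fin R n _ a l l0) => // y [] //.
Qed.

(** A negative median would give concentration at radius 0, where the near set is empty. *)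
Lemma max_median_norm_ge0 f s a l c : 0 < l -> 0 < s -> s <= 1 ->
  measurable_on f (cube a l) ->
  0 <= max_median (fun y => `|f y - c|) (1 - s) (cube a l).
Proof.
move=> l0 s0 s1 mf; rewrite leNgt; apply/negP => m0.
have := concentrated_of_median l0 s0 mf m0; rewrite /concentrated.
rewrite (_ : _ `&` _ = set0); last first.
  by apply/seteqP; split => // y [_]; rewrite /near_set /= normr_lt0.
by rewrite /vol Leb0 /= ltNge mulr_ge0 ?subr_ge0// vol_ge0.
Qed.

(** [c - M] belongs to the set defining the median, since less than [s |Q| <= (1 - s) |Q|] lies off
    the near set; a number above [c + M] does not, since the near set lies below it. *)
Lemma median_center f s a l c M : 0 < l -> s <= 1 / 2 ->
  measurable_on f (cube a l) -> concentrated s f (cube a l) c M ->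
  `|max_median f (1 - s) (cube a l) - c| <= M.
Proof.
move=> l0 s12 mf conc.
have fin X : Leb (cube a l `&` X) \is a fin_num.
  by apply: (@Leb_fin R n _ a l l0) => y [].
have low : (Leb (cube a l `&` [set y | (f y < c - M)%R]) <= (1 - s)%:E * Leb (cube a l))%E.
  have := @concentrated_compl R n s f _ (cube a l `&` [set y | (f y < c - M)%R]) c M a l
    l0 (@subset_refl _ _) mf conc.
  rewrite /vol => H; rewrite -(fineK (fin _)) Leb_cube// -EFinM lee_fin.
  apply: (@le_trans _ _ (s * l ^+ n.+1)); last first.
    by apply: ler_wpM2r; [rewrite exprn_ge0// ltW|lra].
  apply/ltW; move: H; rewrite Leb_cube//; apply; first by move=> y [].
  apply/seteqP; split => // y [[_ /=]]; rewrite /near_set/= ltr_distl.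
  by move=> h /andP[]; lra.
have up M' : (Leb (cube a l `&` [set y | (f y < M')%R]) <= (1 - s)%:E * Leb (cube a l))%E ->
    M' <= c + M.
  apply: contraTT; rewrite -!ltNge => cM.
  rewrite -(fineK (fin _)) Leb_cube// -EFinM lte_fin.
  move: conc; rewrite /concentrated vol_cube// => /lt_le_trans; apply.
  apply: fine_le; rewrite ?fin//; apply: le_Leb => y [ay]; rewrite /near_set/= ltr_distl.
  by move=> /andP[_ yc]; split => //=; exact: lt_trans yc cM.
rewrite ler_distl; apply/andP; split.
  by apply: ub_le_sup => //; exists (c + M).
by apply: ge_sup; first by exists (c - M).
Qed.

(** * From the norm to the deviation from the median *)

Section assembly.
Variables (s : R) (phi : R -> R) (f : T -> R) (a : T) (l : R).
Hypotheses (s_gt0 : 0 < s) (s_le : s <= 1 / 2 ^+ n.+1) (l0 : 0 < l).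
Hypothesis phi_ndecr : {in `[0, +oo[ &, {homo phi : u v / u <= v}}.
Hypothesis phi_gt0 : forall u, 0 < u -> 0 < phi u.
Hypothesis mf : measurable_on f (cube a l).

Local Notation Q := (cube a l).
Local Notation V := (vol Q).
Local Notation deviation lam := (Q `&` [set y | (lam < `|f y - max_median f (1 - s) Q|)%R]).
Local Notation A := (@decay_factor R n).

Lemma bmo_norm_ge0 : (0 <= bmo_norm s phi Q f)%E.
Proof.
have s12 := le_half_of_le_pow s_le.
apply: (@le_trans _ _ (ereal_inf [set
  (max_median (fun y => `|f y - c|) (1 - s) Q / phi (vol Q))%:E | c in [set: R]])).
  apply: le_ereal_inf_tmp => _ [c _ <-]; rewrite lee_fin divr_ge0//.
    by apply: max_median_norm_ge0 => //; lra.
  by apply/ltW/phi_gt0; rewrite vol_cube// exprn_gt0.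
by apply: ereal_sup_ubound; exists Q => //; split => //; exists a, l.
Qed.

Lemma bmo_concentrated N b r : 0 < N -> (bmo_norm s phi Q f < N%:E)%E ->
  0 < r -> cube b r `<=` Q ->
  exists c, concentrated s f (cube b r) c (N * phi (r ^+ n.+1)).
Proof.
move=> N0 fN r0 bQ.
have : (ereal_inf [set
  (max_median (fun y => `|f y - c|) (1 - s) (cube b r) / phi (vol (cube b r)))%:E
    | c in [set: R]] < N%:E)%E.
  apply: le_lt_trans fN; apply: ereal_sup_ubound; exists (cube b r) => //.
  by split => //; exists b, r.
move=> /ereal_inf_lt[_ [c _ <-]]; rewrite lte_fin vol_cube// => h; exists c.
apply: concentrated_of_median => //.
  by apply: measurable_on_sub mf => //; exact: cube_measurable.
by rewrite -ltr_pdivrMr// phi_gt0// exprn_gt0.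
Qed.

(** The 1 in [A + 1] pays for passing from the center to the median. *)
Lemma deviation_decay N k lam : 0 < N -> (bmo_norm s phi Q f < N%:E)%E ->
  (A + 1) * N * (\sum_(j < k) phi (V / (2 ^+ n.+1) ^+ j)) <= lam ->
  (Leb (deviation lam) <= (V / (2 ^+ n.+1) ^+ k)%:E)%E.
Proof.
move=> N0 fN lamS.
have powE i : (l / 2 ^+ i) ^+ n.+1 = V / (2 ^+ n.+1) ^+ i.
  by rewrite vol_cube// expr_div_n -!exprM mulnC.
pose m r := N * phi (r ^+ n.+1).
have m_gt0 r : 0 < r -> 0 < m r by move=> r0; rewrite mulr_gt0// phi_gt0// exprn_gt0.
have m_nd r r' : 0 < r -> r <= r' -> m r <= m r'.
  move=> r0 rr; rewrite /m ler_wpM2l ?(ltW N0)//; apply: phi_ndecr.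
  - by rewrite in_itv/= andbT exprn_ge0// ltW.
  - by rewrite in_itv/= andbT exprn_ge0// (le_trans (ltW r0)).
  - by rewrite lerXn2r// nnegrE ltW// (lt_le_trans r0).
have [c cP] : exists c : set T -> R, forall b r, 0 < r -> cube b r `<=` Q ->
    concentrated s f (cube b r) (c (cube b r)) (m r).
  (* The center depends on the set alone, the radius on the side; this is consistent because a cube
     determines its side. *)
  have /choice[c cP] : forall X : set T, exists c, forall b r, X = cube b r ->
      0 < r -> cube b r `<=` Q -> concentrated s f X c (m r).
    move=> X; have [[b [r [XE r0 bQ]]]|nX] :=
      pselect (exists b r, [/\ X = cube b r, 0 < r & cube b r `<=` Q]).
      have [c cP] := bmo_concentrated N0 fN r0 bQ.
      exists c => b' r' XE' r'0 b'Q; rewrite XE.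
      suff -> : r' = r by [].
      have bb : cube b r = cube b' r' by rewrite -XE.
      have r'r : r' <= r by apply: (@cube_sub_side _ _ b b' r r') => //; rewrite bb.
      have rr' : r <= r' by apply: (@cube_sub_side _ _ b' b r' r) => //; rewrite bb.
      by apply/eqP; rewrite eq_le r'r.
    by exists 0 => b r XE r0 bQ; case: nX; exists b, r.
  by exists c => b r r0 bQ; exact: cP.
have medc := median_center l0 (le_half_of_le_pow s_le) mf (cP _ _ l0 (@subset_refl _ _)).
(* For [k = 0] the empty sum cannot absorb the error of the median, but the bound is trivial. *)
case: k lamS => [_|k lamS].
  by rewrite divr1 vol_cube// -(Leb_cube a l0); apply: le_Leb => y [].
have := @oscillation_decay R n s f c m Q s_gt0 s_le m_gt0 m_nd _ cP k.+1 a l l0 (@subset_refl _ _).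
rewrite powE => H; apply: le_trans (H _); last first.
  by move=> b r r0 bQ; apply: measurable_on_sub mf => //; exact: cube_measurable.
apply: le_Leb => y [ay yl]; split => //=; move: yl => /=.
have -> : \sum_(j < k.+1) m (l / 2 ^+ j) = N * \sum_(j < k.+1) phi (V / (2 ^+ n.+1) ^+ j).
  by rewrite mulr_sumr; apply: eq_bigr => j _; rewrite /m powE.
have : m l <= N * \sum_(j < k.+1) phi (V / (2 ^+ n.+1) ^+ j).
  rewrite /m ler_wpM2l ?(ltW N0)// big_ord_recl divr1 -(vol_cube a l0) lerDl.
  by apply: sumr_ge0 => j _; apply/ltW/phi_gt0; rewrite divr_gt0 ?exprn_gt0// vol_cube// exprn_gt0.
move: lamS medc; have := ler_distD (c Q) (f y) (max_median f (1 - s) Q).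
rewrite (distrC (c Q)) -mulrA; lra.
Qed.

End assembly.
End medians.

Theorem theorem5p1 (R : realType) (n : nat) (Q0 : set 'rV[R]_n.+1)
    (s : R) (phi : R -> R)
    (Q0_cube : is_cube Q0)
    (s_gt0 : 0 < s) (s_le : s <= 1 / 2 ^+ n.+1)
    (phi_cont : {within `[0, +oo[, continuous phi})
    (phi_ndecr : {in `[0, +oo[ &, {homo phi : u v / u <= v}})
    (phi0 : phi 0 = 0)
    (phi_gt0 : forall u, 0 < u -> 0 < phi u) :
  exists c1 c2 : R, [/\ 0 < c1, 0 < c2 &
    forall f : 'rV[R]_n.+1 -> R, bmo s phi Q0 f ->
    forall Q : set 'rV[R]_n.+1, is_cube Q -> Q `<=` Q0 ->
    forall lambda : R, 0 < lambda ->
      (Leb (Q `&` [set y | (lambda < `|f y - max_median f (1 - s) Q|)%R]) <=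
       (if bmo_norm s phi Q f == 0 then 0%R
        else (c1 * Psi_inv n.+1 phi (vol Q)
                     (c2 * lambda / fine (bmo_norm s phi Q f)))%R)%:E)%E].
Proof.
have A0 : 0 < @decay_factor R n + 1 by rewrite /decay_factor ltr_wpDl// addr_ge0// mulr_ge0.
set A := @decay_factor R n in A0.
have D1 : 1 < 2 ^+ n.+1 :> R by rewrite exprn_egt1 ?ltr1n.
have kappa0 : 0 < 1 - (2 ^+ n.+1)^-1 :> R by rewrite subr_gt0 invf_lt1// (lt_trans _ D1).
set kappa : R := 1 - (2 ^+ n.+1)^-1 in kappa0.
(* [kappa] comes from comparing the sum with [Psi], [A + 1] from the decay, 2 from taking [N] twice
   the norm. *)
exists 1, (kappa / (2 * (A + 1))); split => //; first by rewrite divr_gt0// mulr_gt0.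
move=> f [mf0 f_fin] Q [a [l [l0 QE]]] QQ0 lam lam0.
have {}QE : Q = cube a l := QE; subst Q.
have mf : measurable_on f (cube a l).
  apply: measurable_on_sub QQ0 (cube_measurable _ _) _ => B mB.
  apply: mf0 => //; case: Q0_cube => b [r [_ ->]]; exact: cube_measurable.
have V0 : 0 < vol (cube a l) by rewrite vol_cube// exprn_gt0.
have D0 : 0 < 2 ^+ n.+1 :> R by exact: lt_trans D1.
have norm_fin : (bmo_norm s phi (cube a l) f < +oo)%E.
  apply: le_lt_trans f_fin; apply: ereal_sup_le => _ [Q' [cQ' Q'a] <-].
  by exists Q' => //; split => //; exact: subset_trans QQ0.
have norm_ge0 := bmo_norm_ge0 s_gt0 s_le l0 phi_gt0 mf.
have normE : bmo_norm s phi (cube a l) f = (fine (bmo_norm s phi (cube a l) f))%:E.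
  by rewrite fineK// ge0_fin_numE.
have [norm0|norm_neq0] := eqVneq.
  (* With norm 0, [N] can be chosen for each [k] so small that [lam] reaches the threshold; [S + 1]
     avoids dividing by 0 when [k = 0]. *)
  have H k : (Leb (cube a l `&` [set y | (lam < `|f y - max_median f (1 - s) (cube a l)|)%R])
      <= (vol (cube a l) / (2 ^+ n.+1) ^+ k)%:E)%E.
    set S := \sum_(j < k) phi (vol (cube a l) / (2 ^+ n.+1) ^+ j).
    have S0 : 0 <= S.
      by apply: sumr_ge0 => j _; apply/ltW/phi_gt0; rewrite divr_gt0// exprn_gt0.
    have S1 : 0 < (A + 1) * (S + 1) by rewrite mulr_gt0// ltr_wpDl.
    apply: (@deviation_decay R n s phi f a l s_gt0 s_le l0 phi_ndecr phi_gt0 mf (lam / ((A + 1) * (S + 1)))).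
    - by rewrite divr_gt0.
    - by rewrite norm0 lte_fin divr_gt0.
    - rewrite -/A -/S mulrA mulrAC ler_pdivrMr// (mulrC (A + 1) lam) -mulrA ler_pM2l//.
      by rewrite ler_pM2l// lerDl.
  apply/lee_addgt0Pr => e e0; rewrite add0e.
  have [k /ltW ke] := exists_div_pow_lt (vol (cube a l)) D1 e0.
  by apply: le_trans (H k) _; rewrite lee_fin.
rewrite mul1r; set N := fine _ in normE *.
have N0 : 0 < N by rewrite -lte_fin -normE lt_def norm_neq0.
apply: Psi_inv_bound => //; first by rewrite divr_gt0// mulr_gt0// divr_gt0// mulr_gt0.
move=> k kS; apply: (@deviation_decay R n s phi f a l s_gt0 s_le l0 phi_ndecr phi_gt0 mf (2 * N)).
- by rewrite mulr_gt0.
- by rewrite normE lte_fin ltr_pMl// ltr1n.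
- move: kS; rewrite -/kappa -/A; set S := \sum_(j < k) _ => kS.
  have : kappa * S * (2 * (A + 1) * N) <= kappa * lam.
    have -> : kappa * lam = kappa / (2 * (A + 1)) * lam / N * (2 * (A + 1) * N).
      by field; rewrite !gt_eqF.
    by rewrite ler_pM2r// !mulr_gt0.
  have -> : kappa * S * (2 * (A + 1) * N) = kappa * ((A + 1) * (2 * N) * S) by ring.
  by rewrite ler_pM2l.
Qed.
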